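(* Let $(\mathbf V,S^* )$ be a monotone sampling scheme, $f:\mathbf V\to[0,\infty)$, and $\prec$ a partial order on $\mathbf V$. Suppose that: (1) for all $v\in\mathbf V$, $\lim_{u\to0^+}\underline f(u,v)=f(v)$; (2) for all $\rho\in(0,1]$, all $v\in\mathbf V$, all $x\in(0,\underline f(\rho,v)]$ and all $z,w\in\min_\prec(S^*(\rho,v))$, $$\inf_{0\le\eta<\rho}\frac{\underline f(\eta,z)-x}{\rho-\eta}=\inf_{0\le\eta<\rho}\frac{\underline f(\eta,w)-x}{\rho-\eta};$$ (3) for every outcome $S=S(u,y)$ and every $v\in S^*(u,y)$ there is $z\in\min_\prec(S^*(u,y))$ with $z\preceq v$; (4) for every $v\in\mathbf V$ there is a finite set $R\subseteq\mathbf V$ such that for all $u\in(0,1]$ there is $z\in R$ with $z\in\min_\prec(S^*(u,v))$. Then a $\prec^+$-optimal estimator for $f$ exists and must be equivalent to a solution $\hat f$ of $$\hat f(\rho,v)=\lambda\big(\rho,\min_\prec(S^*(\rho,v))\big)\quad\text{for all } v\in\mathbf V,\ \rho\in(0,1],$$ where $\lambda(\rho,\min_\prec(S^*(\rho,v)))$ denotes the common value, over $z\in\min_\prec(S^*(\rho,v))$, of $\lambda(\rho,z)=\inf_{0\le\eta<\rho}\frac{\underline f(\eta,z)-\int_\rho^1\hat f(u,v)\,du}{\rho-\eta}$.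
   Context: A monotone sampling scheme consists of a set $\mathbf V$ (the data domain) and a map assigning to each seed $u\in(0,1]$ and data vector $v\in\mathbf V$ a set $S^*(u,v)\subseteq\mathbf V$ with $v\in S^*(u,v)$, such that for each fixed $v$ the set $S^*(u,v)$ is non-decreasing (under inclusion) in $u$. The outcome (sample) $S(u,v)$ of data $v$ with seed $u$ includes the seed $u$, and $S^*(u,v)$ is the set of all data vectors consistent with the outcome: $z\in S^*(u,v)$ implies $S(u,z)=S(u,v)$ and $S^*(u,z)=S^*(u,v)$. Standing assumption: if $z\in S^*(\rho,v)$ then there is $\epsilon>0$ such that $z\in S^*(x,v)$ for all $x\in(\rho-\epsilon,1]\cap(0,1]$. An estimator $\hat f$ is a real-valued function of the outcome; write $\hat f(u,v)=\hat f(S(u,v))$ (so $\hat f(u,z)=\hat f(u,v)$ whenever $z\in S^*(u,v)$); it is assumed Lebesgue integrable in $u\in(0,1]$ for each $v$. The seed is uniform on $[0,1]$. $\hat f$ is nonnegative if $\hat f(u,v)\ge0$ for all $u,v$, and unbiased if $\int_0^1\hat f(u,v)\,du=f(v)$ for all $v$; its variance on $v$ is then $\int_0^1\hat f(u,v)^2du-f(v)^2$. Two estimators are equivalent if for every $v$ they agree for almost every $u\in(0,1]$. Lower bound function: $\underline f(u,v)=\inf\{f(z): z\in S^*(u,v)\}$ for $u\in(0,1]$, with $\underline f(0,v)=\lim_{u\to0^+}\underline f(u,v)$. $\prec$ is a strict partial order; $z\preceq v$ means $z\prec v$ or $z=v$. For $Z\subseteq\mathbf V$, $\min_\prec(Z)=\{z\in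 Z:\ \text{there is no } w\in Z \text{ with } w\prec z\}$. A nonnegative unbiased estimator $\hat f$ is $\prec^+$-optimal if there is no other nonnegative unbiased estimator with strictly lower variance on some data $v$ and at most the variance of $\hat f$ on all vectors that precede $v$.
   Formalization: The formal theorem additionally assumes that for every data vector v some nonnegative unbiased estimator has finite variance on v; without this the claim fails, e.g. for f(z)=1-√z on [0,1] with S*(u,v)=[0,u) if v<u, else {v}, and 0 preceding every z>0. *)

(* Defs.v *)
From mathcomp Require Import all_boot all_order all_algebra.
From mathcomp Require Import all_classical all_reals all_analysis.
Import Order.TTheory GRing.Theory Num.Theory.
Import numFieldNormedType.Exports.

Set Implicit Arguments.
Unset Strict Implicit.
Unset Printing Implicit Defensive.

Local Open Scope classical_set_scope.
Local Open Scope ring_scope.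

(* Seeds are reals in ]0, 1]; [sstar u v] is unconstrained for other [u]. *)
Record sampling_scheme (R : realType) (V : Type) := SamplingScheme {
  sstar :> R -> V -> set V;
  sstar_refl : forall u v, 0 < u <= 1 -> sstar u v v;
  sstar_mono : forall u u' v,
    0 < u -> u <= u' -> u' <= 1 -> sstar u v `<=` sstar u' v;
  sstar_consistent : forall u v z,
    0 < u <= 1 -> sstar u v z -> sstar u z = sstar u v;
  sstar_left_open : forall rho v z,
    0 < rho <= 1 -> sstar rho v z ->
    exists2 eps : R, 0 < eps &
      forall x, rho - eps < x -> 0 < x <= 1 -> sstar x v z
}.

Section scheme.
Context {R : realType} {V : Type}.
Variables (S : sampling_scheme R V) (f : V -> R).

Local Notation mu := (@lebesgue_measure R).

Definition seeds : set R := `]0, 1].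

(* Two data vectors give the same outcome at seed u exactly when they have the
   same set of consistent vectors, so the outcome is encoded by the seed
   together with that set. *)
Definition outcome (u : R) (v : V) : R * set V := (u, S u v).

Definition est_at (e : R * set V -> R) (u : R) (v : V) : R := e (outcome u v).

Definition is_estimator (e : R * set V -> R) : Prop :=
  forall v, mu.-integrable seeds (fun u => (est_at e u v)%:E).

Definition nonneg_estimator (e : R * set V -> R) : Prop :=
  forall u v, 0 < u <= 1 -> 0 <= est_at e u v.

Definition unbiased (e : R * set V -> R) : Prop :=
  forall v, \int[mu]_(u in seeds) est_at e u v = f v.

Definition nonneg_unbiased (e : R * set V -> R) : Prop :=
  [/\ is_estimator e, nonneg_estimator e & unbiased e].

(* Extended-real valued: +oo when the estimator is not square integrable. *)
Definition est_variance (e : R * set V -> R) (v : V) : \bar R :=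
  (\int[mu]_(u in seeds) (est_at e u v ^+ 2)%:E - (f v ^+ 2)%:E)%E.

Definition est_equivalent (e g : R * set V -> R) : Prop :=
  forall v, {ae mu, forall u, seeds u -> est_at e u v = est_at g u v}.

Definition lower_bound_seed (u : R) (v : V) : R := inf [set f z | z in S u v].

Definition lower_bound (u : R) (v : V) : R :=
  if u == 0 then lim (lower_bound_seed t v @[t --> 0^'+])
  else lower_bound_seed u v.

Definition inf_slope (rho : R) (z : V) (x : R) : \bar R :=
  ereal_inf [set ((lower_bound eta z - x) / (rho - eta))%:E
            | eta in `[0, rho[].

Variable prec : V -> V -> Prop.

Definition min_prec (Z : set V) : set V :=
  [set z | Z z /\ ~ exists2 w, Z w & prec w z].

Definition prec_plus_optimal (e : R * set V -> R) : Prop :=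
  nonneg_unbiased e /\
  ~ exists2 g, nonneg_unbiased g &
      exists2 v, (est_variance g v < est_variance e v)%E &
        forall z, prec z v -> (est_variance g z <= est_variance e z)%E.

(* z ranges over data consistent with the outcome of v at rho; e is integrated
   along v, as in the displayed formula, which agrees with e along z above rho. *)
Definition lambda_slope (e : R * set V -> R) (rho : R) (v z : V) : \bar R :=
  inf_slope rho z (\int[mu]_(u in `]rho, 1]) est_at e u v).

Definition lambda_solution (e : R * set V -> R) : Prop :=
  is_estimator e /\
  forall v rho, 0 < rho <= 1 ->
    forall z, min_prec (S rho v) z -> (est_at e rho v)%:E = lambda_slope e rho v z.

End scheme.

(* Main.v *)
(* Along a single data vector z that is minimal at seed c, write L for its
   lower bound function and M for the mass an estimator has already placed
   above c.  The equation defining lambda says that the estimator is minus the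
   left slope of the largest convex function lying below L and passing through
   (c, M); this exists, and it is the unique minimizer of the second moment
   among the feasible continuations below c.  For the latter, both the convex
   function and any feasible primitive lie below L, and the convex function
   touches L wherever its slope g drops; hence a competitor phi has at least the
   mass of g on each superlevel set of g, and a layer-cake sum gives
   int g^2 <= int phi^2.  The parallelogram identity upgrades this to uniqueness.

   By (4), the seeds along any v split into finitely many intervals on each of
   which a fixed vector is minimal, so these pieces glue to a solution along v;
   a comparison argument shows that the solution is unique, so it depends on the
   outcome only.  If an estimator agrees with the solution above c and does at
   least as well on a vector minimal at c, strict optimality forces agreement
   below c as well.  For optimality of the solution the minimal vector is taken
   from (3); conversely, if a given optimal estimator were beaten on a minimal z,
   replacing it by the solution on the outcomes below that of z at seed c
   would improve it on z without affecting any vector preceding z. *)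
Require Import Defs.
From Stdlib Require Import RelationClasses.
From Stdlib Require List.
From mathcomp Require Import all_boot all_order all_algebra.
From mathcomp Require Import all_classical all_reals all_analysis.
From mathcomp Require Import measurable_realfun lra ring.
Set Implicit Arguments.
Unset Strict Implicit.
Unset Printing Implicit Defensive.
Import Order.TTheory GRing.Theory Num.Theory.
Import numFieldNormedType.Exports.
Local Open Scope classical_set_scope.
Local Open Scope ring_scope.

(** * Integrals over half-open intervals *)

Section integrals.
Context {R : realType}.
Local Notation mu := (@lebesgue_measure R).
Implicit Types (f g h : R -> R) (a b c x y u e d k B : R).

Definition itg f a b : R := \int[mu]_(u in `]a, b]) f u.
Definition integ f a b : Prop := mu.-integrable `]a, b] (EFin \o f).

Lemma integS f a b a' b' : a <= a' -> b' <= b -> integ f a b -> integ f a' b'.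
Proof.
move=> aa bb; apply: integrableS => //.
by apply: subset_itv; rewrite bnd_simp.
Qed.

Lemma itg_split f a b c : a <= b -> b <= c -> integ f a c ->
  itg f a c = itg f a b + itg f b c.
Proof.
move=> ab bc fi; rewrite /itg -(@Rintegral_itvB _ f (BRight a) (BRight c) b) //.
by rewrite addrC subrK.
Qed.

Lemma itg_le f g a b : integ f a b -> integ g a b ->
  (forall x, a < x -> x <= b -> f x <= g x) -> itg f a b <= itg g a b.
Proof.
move=> fi gi fg; apply: le_Rintegral => // x /=.
by rewrite in_itv /= => /andP[]; exact: fg.
Qed.

Lemma itg_ge0 f a b : (forall x, a < x -> x <= b -> 0 <= f x) -> 0 <= itg f a b.
Proof.
move=> f0; apply: Rintegral_ge0 => x /=; rewrite in_itv /= => /andP[]; exact: f0.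
Qed.

Lemma mu_itv a b : a <= b -> mu `]a, b]%classic = (b - a)%:E.
Proof.
rewrite lebesgue_measure_itv /= lte_fin.
by case: ltgtP => // -> _; rewrite subrr.
Qed.

Lemma mu_itv_lty a b : (mu `]a, b]%classic < +oo)%E.
Proof. by rewrite lebesgue_measure_itv /=; case: ifP => _; rewrite ?ltry. Qed.

Lemma integ_cst k a b : integ (fun=> k) a b.
Proof.
apply: measurable_bounded_integrable => //.
  exact: mu_itv_lty.
by exists `|k|; split=> [|M kM x _]; rewrite ?num_real //= ltW.
Qed.

Lemma itg_cst k a b : a <= b -> itg (fun=> k) a b = k * (b - a).
Proof.
move=> ab; rewrite /itg Rintegral_cst //.
exact: (congr1 (fun m => k * fine m) (mu_itv ab)).
Qed.

Lemma eq_itg f g a b : (forall x, a < x -> x <= b -> f x = g x) ->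
  itg f a b = itg g a b.
Proof.
move=> fg; apply: eq_Rintegral => x; rewrite inE /= in_itv /= => /andP[]; exact: fg.
Qed.

Lemma eq_integ f g a b : (forall x, a < x -> x <= b -> f x = g x) ->
  integ f a b -> integ g a b.
Proof.
move=> fg; apply: eq_integrable => // x.
by rewrite inE /= in_itv /= => /andP[ax xb] /=; rewrite fg.
Qed.

Lemma itg_refl f a : itg f a a = 0.
Proof. by rewrite /itg set_itv_ge ?Rintegral_set0 // bnd_simp ltxx. Qed.

Lemma itgD f g a b : integ f a b -> integ g a b ->
  itg (fun x => f x + g x) a b = itg f a b + itg g a b.
Proof. by move=> fi gi; exact: RintegralD. Qed.

Lemma itgB f g a b : integ f a b -> integ g a b ->
  itg (fun x => f x - g x) a b = itg f a b - itg g a b.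
Proof. by move=> fi gi; exact: RintegralB. Qed.

Lemma itgZ f k a b : integ f a b -> itg (fun x => k * f x) a b = k * itg f a b.
Proof. by move=> fi; exact: RintegralZl. Qed.

Lemma integD f g a b : integ f a b -> integ g a b ->
  integ (fun x => f x + g x) a b.
Proof. by move=> fi gi; exact: (integrableD _ fi gi). Qed.

Lemma integB f g a b : integ f a b -> integ g a b ->
  integ (fun x => f x - g x) a b.
Proof. by move=> fi gi; exact: (integrableB _ fi gi). Qed.

Lemma integZ f k a b : integ f a b -> integ (fun x => k * f x) a b.
Proof. by move=> fi; exact: (integrableZl _ _ fi). Qed.

Lemma itg_small f a b e : integ f a b -> 0 < e ->
  exists2 d, 0 < d & forall x y, a <= x -> x <= y -> y <= b -> y - x < d ->
    `|itg f x y| < e.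
Proof.
move=> fi e0.
have /integral_normr_continuous /(_ _ e0) [d [d0 dP]] :
    mu.-integrable setT (EFin \o (f \_ `]a, b])).
  by rewrite -restrict_EFin; apply/integrable_restrict => //=; rewrite setTI.
exists d => // x y ax xy yb yxd.
have sub : `]x, y] `<=` (`]a, b] : set R) by apply: subset_itv; rewrite bnd_simp.
have fxy : integ f x y by exact: integS fi.
apply: (le_lt_trans (le_normr_Rintegral _ fxy)) => //.
rewrite -(setIidl sub) Rintegral_mkcondr /=.
under eq_Rintegral do rewrite restrict_normr.
apply: dP => //; apply: (eq_ind_r (fun m => (m < d%:E)%E) _ (mu_itv xy)).
by rewrite lte_fin.
Qed.

(** Preimages of rays under an antitone function are intervals. *)
Lemma antitone_measurable g a b :
  (forall x y, a < x -> x <= y -> y <= b -> g y <= g x) ->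
  measurable_fun (`]a, b] : set R) g.
Proof.
move=> gd; apply: (measurability (@RGenCInfty.G R)) => [|/= _ [_] [r] -> <-].
  exact: RGenCInfty.measurableE.
apply: is_interval_measurable => s t /=.
rewrite !in_itv /= !andbT => -[/andP[as_ sb] rs] [/andP[at_ tb] rt] u /andP[su ut].
rewrite !in_itv /=; split; first by rewrite (lt_le_trans as_ su) (le_trans ut tb).
rewrite andbT; apply: (le_trans rt); apply: gd => //; exact: lt_le_trans su.
Qed.

Lemma antitone_integ g a b x :
  (forall x y, a < x -> x <= y -> y <= b -> g y <= g x) -> a < x ->
  integ g x b.
Proof.
move=> gd ax.
have [xb|bx] := leP x b; last first.
  by rewrite /integ set_itv_ge ?bnd_simp -?leNgt ?ltW //; exact: integrable_set0.
apply: measurable_bounded_integrable => //.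
- exact: mu_itv_lty.
- by apply: antitone_measurable => s t xs; apply: gd; exact: lt_trans xs.
- exists (Num.max `|g x| `|g b|); split; first by rewrite num_real.
  move=> M /= + u; rewrite in_itv /= gt_max => /andP[gxM gbM] /andP[xu ub].
  have := gd _ _ ax (ltW xu) ub; have := gd _ _ (lt_trans ax xu) ub (lexx b).
  move: gxM gbM; rewrite !ltr_norml ler_norml => /andP[? ?] /andP[? ?] ? ?; lra.
Qed.

(** Monotone convergence along the points [xn n] decreasing to [a]: integrability up to [a], where
    [g] may be unbounded, comes from control on each []x, b]]. *)
Lemma itg_limit g (H : R -> R) (l a b : R) : a < b ->
  measurable_fun (`]a, b] : set R) g ->
  (forall x, a < x -> x <= b -> 0 <= g x) ->
  (forall x, a < x -> x <= b -> integ g x b /\ itg g x b = H x) ->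
  H x @[x --> a^'+] --> l ->
  integ g a b /\ itg g a b = l.
Proof.
move=> ab mg g0 gH Hl.
pose xn n : R := a + (b - a) / n.+1%:R.
have ba0 : 0 < b - a by rewrite subr_gt0.
have axn n : a < xn n by rewrite /xn ltrDl divr_gt0.
have xnb n : xn n <= b.
  by rewrite /xn -lerBrDl ler_pdivrMr // ler_peMr ?ler1n // ltW.
pose F n : set R := `]xn n, b]%classic.
have FU : \bigcup_n F n = `]a, b]%classic.
  apply/seteqP; split => [u [n _] | u] /=.
    by rewrite /F /= !in_itv /= => /andP[xu ->]; rewrite (lt_trans (axn n)).
  rewrite in_itv /= => /andP[au ub].
  have [n /= nP] : exists n : nat, (b - a) / (u - a) < n%:R.
    exists (Num.bound ((b - a) / (u - a))).
    by rewrite archi_boundP // divr_ge0 // ltW // subr_gt0.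
  exists n => //; rewrite /F /= in_itv /= ub andbT /xn -ltrBrDl.
  rewrite ltr_pdivrMr // mulrC -ltr_pdivrMr ?subr_gt0 //.
  by apply: (lt_trans nP); rewrite ltr_nat.
have xna : xn @ \oo --> a.
  rewrite /xn -[X in _ --> X]addr0; apply: cvgD; first exact: cvg_cst.
  rewrite -(mulr0 (b - a)); apply: cvgM; first exact: cvg_cst.
  exact: cvg_harmonic.
have /cvg_at_rightP /(_ xn (conj axn xna)) Hxn := Hl.
have FH n : (\int[mu]_(x in F n) (g x)%:E = (H (xn n))%:E)%E.
  have [gi <-] := gH _ (axn n) (xnb n).
  rewrite /itg /Rintegral fineK //; exact: (integrable_fin_num _ gi).
have Fl : (\int[mu]_(x in F n) (g x)%:E)%E @[n --> \oo] --> l%:E.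
  under eq_cvg do rewrite FH.
  by apply: cvg_EFin => //; near=> n.
have FI : (\int[mu]_(x in F n) (g x)%:E)%E @[n --> \oo]
    --> (\int[mu]_(x in \bigcup_n F n) (g x)%:E)%E.
  apply: (@ge0_nondecreasing_set_cvg_integral _ (measurableTypeR R) R F
    (fun x => (g x)%:E) mu) => //.
  - move=> m n mn; rewrite subsetEset; apply: subset_itvr; rewrite bnd_simp /xn.
    by rewrite lerD2l ler_pM2l // lef_pV2 ?posrE // ler_nat.
  - by move=> n; exact: measurable_itv.
  - move=> n; apply/measurable_EFinP; apply: measurable_funS mg => //.
    by apply: subset_itvr; rewrite bnd_simp ltW.
  - move=> n x; rewrite /F /= in_itv /= => /andP[nx xb].
    by rewrite lee_fin g0 // (lt_trans (axn n)).
have E := cvg_unique (@ereal_hausdorff R) Fl FI; rewrite FU in E.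
split; last by rewrite /itg /Rintegral -E.
apply/integrableP; split; first exact/measurable_EFinP.
suff -> : (\int[mu]_(x in `]a, b]) `|(EFin \o g) x| = l%:E)%E by rewrite ltry.
rewrite E; apply: eq_integral => x.
by rewrite inE /= in_itv /= => /andP[ax xb]; rewrite /= ger0_norm // g0.
Unshelve. all: by end_near. Qed.

Lemma integ_le f h a b : measurable_fun (`]a, b]%classic : set R) f ->
  (forall x, a < x -> x <= b -> `|f x| <= h x) -> integ h a b -> integ f a b.
Proof.
move=> mf fh; apply: le_integrable => //; first exact/measurable_EFinP.
move=> x; rewrite /= in_itv /= => /andP[ax xb].
by rewrite lee_fin (le_trans (fh _ ax xb)) // ler_norm.
Qed.

Lemma integ_measurable f a b : integ f a b ->
  measurable_fun (`]a, b]%classic : set R) f.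
Proof. by move=> /measurable_int /measurable_EFinP. Qed.

Lemma integ_Mbounded f h a b k : measurable_fun (`]a, b]%classic : set R) f ->
  (forall x, a < x -> x <= b -> `|f x| <= k) -> integ h a b ->
  integ (fun x => f x * h x) a b.
Proof.
move=> mf fk hi; suff fb : [bounded f x | x in `]a, b]%classic].
  by have := @integrableMr _ _ _ mu _ (measurable_itv _) f (EFin \o h) mf fb hi.
exists k; split; first by rewrite num_real.
move=> M kM x /=; rewrite in_itv /= => /andP[ax xb].
exact: le_trans (fk _ ax xb) (ltW kM).
Qed.

(** The integrals over []x, b]] grow as [x] decreases to [a], so they converge to their supremum and
    [itg_limit] applies. *)
Lemma itg_bounded g a b B : a < b ->
  measurable_fun (`]a, b]%classic : set R) g ->
  (forall x, a < x -> x <= b -> 0 <= g x) ->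
  (forall x, a < x -> x <= b -> integ g x b) ->
  (forall x, a < x -> x <= b -> itg g x b <= B) ->
  integ g a b /\ itg g a b <= B.
Proof.
move=> ab mg g0 gi gB.
pose A := [set itg g x b | x in `]a, b]].
have A0 : A !=set0 by exists (itg g b b); exists b => //=; rewrite in_itv /= ab lexx.
have AB : ubound A B by move=> _ [x + <-]; rewrite /= in_itv /= => /andP[]; exact: gB.
have [] := @itg_limit g (fun x => itg g x b) (sup A) a b ab mg g0.
- by move=> x ax xb; split => //; exact: gi.
- apply/cvgrPdist_le => e e0.
  have [_ [z + <-]] := sup_adherent e0 (conj A0 (ex_intro _ B AB)).
  rewrite /= in_itv /= => /andP[az zb] ze.
  near=> x.
  have ax : a < x by near: x; exact: nbhs_right_gt.
  have xz : x <= z by near: x; exact: nbhs_right_le.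
  have xb := le_trans xz zb.
  have h1 : itg g x b <= sup A.
    by apply: ub_le_sup; [exists B|exists x => //=; rewrite in_itv /= ax].
  have h2 : itg g z b <= itg g x b.
    rewrite (itg_split xz zb (gi _ ax xb)) lerDr; apply: itg_ge0 => u xu uz.
    by apply: g0; [exact: lt_trans xu|exact: le_trans zb].
  rewrite ler_norml; lra.
move=> gi0 ->; split => //; exact: ge_sup.
Unshelve. all: by end_near. Qed.

Lemma ae_imp (P Q : R -> Prop) : (forall x, P x -> Q x) ->
  {ae mu, forall x, P x} -> {ae mu, forall x, Q x}.
Proof. by move=> PQ; apply: (@filterS _ _ (ae_filter_ringOfSetsType mu)). Qed.

Lemma itg_eq0_ae f a b : integ f a b -> (forall x, 0 <= f x) -> itg f a b = 0 ->
  {ae mu, forall x, a < x <= b -> f x = 0}.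
Proof.
move=> fi f0 fab.
have [+ _] := @ae_eq_integral_abs _ _ R mu _ (measurable_itv _) (EFin \o f)
  (measurable_int _ fi).
have -> : (\int[mu]_(x in `]a, b]) `|(EFin \o f) x| = 0)%E; last first.
  move=> /(_ erefl); apply: ae_imp => x /= + xab.
  by rewrite in_itv => /(_ xab) [].
transitivity (\int[mu]_(x in `]a, b]) (f x)%:E)%E.
  by apply: eq_integral => x _; rewrite /= ger0_norm.
transitivity (itg f a b)%:E; last by rewrite fab.
rewrite /itg /Rintegral fineK //; exact: (integrable_fin_num _ fi).
Qed.

Lemma eq_itg_open f h a b : integ f a b -> integ h a b ->
  (forall x, a < x -> x < b -> f x = h x) -> itg f a b = itg h a b.
Proof.
move=> fi hi fh; rewrite /itg -!Rintegral_itv_bndo_bndc //; last 2 first.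
- by apply: integrableS hi => //; apply: subset_itvl; rewrite bnd_simp.
- by apply: integrableS fi => //; apply: subset_itvl; rewrite bnd_simp.
apply: eq_Rintegral => x; rewrite inE /= in_itv /= => /andP[]; exact: fh.
Qed.

Lemma integ_cat f a b c : a <= b -> b <= c -> integ f a b -> integ f b c ->
  integ f a c.
Proof.
move=> ab bc /integrableP[mf fi] /integrableP[mf' fi'].
rewrite /integ (@itv_bndbnd_setU _ _ _ (BRight b)) ?bnd_simp //.
have mU : measurable_fun (`]a, b] `|` `]b, c]) (EFin \o f) by exact/measurable_funU.
apply/integrableP; split => //.
rewrite ge0_integral_setU //=.
- exact: lte_add_pinfty.
- by apply/measurable_EFinP; apply: measurableT_comp => //; exact/measurable_EFinP.
- apply/disj_setPS => x [] /=; rewrite !in_itv /= => /andP[_ xb] /andP[bx _].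
  by move: bx; rewrite ltNge xb.
Qed.

Lemma integ_if f g a b c : a <= b -> b <= c -> integ f a b -> integ g b c ->
  integ (fun x => if x <= b then f x else g x) a c.
Proof.
move=> ab bc fi gi; apply: (integ_cat ab bc).
  by apply: eq_integ fi => x _ ->.
by apply: eq_integ gi => x bx _; rewrite leNgt bx.
Qed.

Lemma ae_eq_itg f g a b : integ f a b -> integ g a b ->
  {ae mu, forall x, a < x <= b -> f x = g x} -> itg f a b = itg g a b.
Proof.
move=> /measurable_int mf /measurable_int mg fg; congr fine.
apply: ae_eq_integral => //.
by apply: ae_imp fg => x fgx; rewrite /= in_itv => /fgx ->.
Qed.

Lemma ae_and (P Q T : R -> Prop) : (forall x, P x -> Q x -> T x) ->
  {ae mu, forall x, P x} -> {ae mu, forall x, Q x} -> {ae mu, forall x, T x}.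
Proof.
move=> PQT P_ Q_; have := @filterI _ _ (ae_filter_ringOfSetsType mu) _ _ P_ Q_.
by apply: ae_imp => x [] ; exact: PQT.
Qed.

End integrals.

(** * Last crossings of uniformly continuous functions *)

Section crossing.
Context {R : realType}.
Implicit Types (f D : R -> R) (a b x y s e d k m : R).

(** Uniform continuity in this ordered form matches [itg_small], so it applies at once to
    primitives. *)
Definition ucont D a b : Prop := forall e, 0 < e -> exists2 d, 0 < d &
  forall x y, a <= x -> x <= y -> y <= b -> y - x < d -> `|D y - D x| < e.

Lemma ucont_itg f a b : integ f a b -> ucont (itg f a) a b.
Proof.
move=> fi e e0; have [d d0 dP] := itg_small fi e0; exists d => // x y ax xy yb xyd.
rewrite (itg_split ax xy); last exact: integS fi.
by rewrite addrC addKr; exact: dP.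
Qed.

Lemma ucont_lin k m a b : ucont (fun x => m - k * x) a b.
Proof.
move=> e e0; exists (e / (`|k| + 1)); first by rewrite divr_gt0 // ltr_wpDl.
move=> x y _ xy _; rewrite ltr_pdivlMr ?ltr_wpDl // => xyd.
rewrite (_ : _ - _ = k * (x - y)); last by ring.
rewrite normrM distrC (ger0_norm (_ : 0 <= y - x)) ?subr_ge0 //.
apply: le_lt_trans xyd; rewrite mulrC ler_wpM2l ?subr_ge0 //; lra.
Qed.

Lemma ucontB D D' a b : ucont D a b -> ucont D' a b -> ucont (fun x => D x - D' x) a b.
Proof.
move=> h h' e e0; have e2 : 0 < e / 2 by rewrite divr_gt0.
have [d d0 dP] := h _ e2; have [d' d'0 d'P] := h' _ e2.
exists (Num.min d d'); first by rewrite lt_min d0.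
move=> x y ax xy yb; rewrite lt_min => /andP[xyd xyd'].
have := dP _ _ ax xy yb xyd; have := d'P _ _ ax xy yb xyd'.
rewrite !ltr_norml => /andP[? ?] /andP[? ?]; lra.
Qed.

Lemma ucontS D a b a' b' : a <= a' -> b' <= b -> ucont D a b -> ucont D a' b'.
Proof.
move=> aa bb h e e0; have [d d0 dP] := h _ e0; exists d => // x y ax xy yb.
by apply: dP => //; [exact: le_trans ax|exact: le_trans bb].
Qed.

(** The point is the supremum of the set where [D] is nonnegative; continuity puts it in that
    set. *)
Lemma last_crossing D a b : a <= b -> ucont D a b -> 0 <= D a -> D b < 0 ->
  exists2 s, a <= s < b & 0 <= D s /\ forall x, s < x -> x <= b -> D x < 0.
Proof.
move=> ab Dc Da Db.
pose A := [set x | a <= x <= b /\ 0 <= D x].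
have A0 : A !=set0 by exists a; split; rewrite ?lexx.
have AB : ubound A b by move=> x [/andP[]].
have As : has_sup A by split => //; exists b.
have As' : a <= sup A by apply: ub_le_sup; [exists b|split; rewrite ?lexx].
have sb : sup A <= b by exact: ge_sup.
have Ds : 0 <= D (sup A).
  rewrite leNgt; apply/negP => Ds.
  have [|d d0 dP] := Dc (- D (sup A)); first by rewrite oppr_gt0.
  have [z [/andP[az zb] Dz] zs] := sup_adherent d0 As.
  have zs' : z <= sup A by apply: ub_le_sup; [exists b|split; rewrite ?az].
  have := dP z (sup A) az zs' sb; rewrite ltr_norml => /(_ _)/andP[]; first by lra.
  lra.
exists (sup A).
  rewrite As' lt_neqAle sb andbT; apply: contraL Ds => /eqP ->.
  by rewrite -ltNge.
split => // x sx xb; rewrite ltNge; apply/negP => Dx.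
have : x <= sup A.
  apply: ub_le_sup; first by exists b.
  by split=> //; rewrite xb andbT (le_trans As') // ltW.
by rewrite leNgt sx.
Qed.

Lemma first_nonpos D a b : a <= b -> ucont D a b -> 0 < D a -> D b <= 0 ->
  exists2 s, a < s <= b & D s <= 0 /\ forall x, a <= x -> x < s -> 0 < D x.
Proof.
(* Reflecting the interval and negating [D] turns a first point into a last crossing. *)
move=> ab Dc Da Db; pose E x := - D (a + b - x).
have Ec : ucont E a b.
  move=> e e0; have [d d0 dP] := Dc e e0; exists d => // x y ax xy yb xyd.
  rewrite /E (_ : _ - _ = D (a + b - x) - D (a + b - y)); last by ring.
  by apply: dP; lra.
have Ea : 0 <= E a by rewrite /E (_ : a + b - a = b) ?oppr_ge0 //; ring.
have Eb : E b < 0 by rewrite /E (_ : a + b - b = a) ?oppr_lt0 //; ring.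
have [s /andP[as_ sb] [Es EsP]] := last_crossing ab Ec Ea Eb.
exists (a + b - s); first by apply/andP; split; lra.
split; first by rewrite -oppr_ge0.
move=> x ax xs; have := EsP (a + b - x); rewrite /E oppr_lt0.
have -> : a + b - (a + b - x) = x by ring.
by apply; lra.
Qed.

End crossing.

(** * Convex minorants *)

Section hull.
Context {R : realType}.
Implicit Types (g H L : R -> R) (a b c x y e k M m t eta : R).

Lemma le0_of_pow2 (D C : R) : 0 <= C -> (forall n, D <= C / 2 ^+ n) -> D <= 0.
Proof.
move=> C0 DC; rewrite leNgt; apply/negP => D0.
pose n := Num.bound (C / D).
have nP : C / D < n%:R by apply: archi_boundP; rewrite divr_ge0 // ltW.
have := DC n; rewrite leNgt => /negP; apply.
rewrite ltr_pdivrMr ?exprn_gt0 // mulrC -ltr_pdivrMr //; apply: (lt_trans nP).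
by rewrite -natrX ltr_nat ltn_expl.
Qed.

(* Bisecting [x, y] n times divides the error of the integral by 2 ^ n. *)
Lemma secant_itg g H c :
  (forall x y, 0 < x -> x <= y -> y <= c -> g y <= g x) ->
  (forall x y, 0 < x -> x < y -> y <= c -> g y * (y - x) <= H x - H y) ->
  (forall x y, 0 < x -> x < y -> y <= c -> H x - H y <= g x * (y - x)) ->
  forall x, 0 < x -> x <= c -> itg g x c = H x - H c.
Proof.
move=> gd secl secr.
have gi x y : 0 < x -> y <= c -> integ g x y.
  move=> x0 yc; apply: (integS (lexx x) yc); exact: antitone_integ gd x0.
have bis n : forall x y, 0 < x -> x <= y -> y <= c ->
    `|itg g x y - (H x - H y)| <= (g x - g y) * (y - x) / 2 ^+ n.
  elim: n => [|n IH] x y x0 xy yc.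
    rewrite expr0 divr1.
    have := xy; rewrite le_eqVlt => /predU1P[->|xy'].
      by rewrite itg_refl !subrr normr0 mulr0.
    have l1 := secl _ _ x0 xy' yc; have l2 := secr _ _ x0 xy' yc.
    have u1 : itg g x y <= g x * (y - x).
      rewrite -itg_cst //; apply: itg_le; [exact: gi|exact: integ_cst|].
      move=> u xu uy; apply: gd => //; [exact: ltW|exact: le_trans yc].
    have u2 : g y * (y - x) <= itg g x y.
      rewrite -itg_cst //; apply: itg_le; [exact: integ_cst|exact: gi|].
      move=> u xu uy; apply: gd => //; exact: lt_trans xu.
    rewrite mulrBl ler_norml; lra.
  pose z := (x + y) / 2.
  have xz : x <= z by rewrite /z; lra.
  have zy : z <= y by rewrite /z; lra.
  have b1 := IH x z x0 xz (le_trans zy yc).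
  have b2 := IH z y (lt_le_trans x0 xz) zy yc.
  rewrite (itg_split xz zy (gi _ _ x0 yc)).
  have -> : itg g x z + itg g z y - (H x - H y) =
    (itg g x z - (H x - H z)) + (itg g z y - (H z - H y)) by ring.
  apply: (le_trans (ler_normD _ _)); apply: (le_trans (lerD b1 b2)).
  rewrite exprS invfM -!mulrA -subr_ge0.
  rewrite (_ : _ - _ = 0) // /z; field.
  by rewrite expf_neq0.
move=> x x0 xc; apply/eqP; rewrite -subr_eq0 -normr_le0.
apply: (@le0_of_pow2 _ ((g x - g c) * (c - x))); last by move=> n; exact: bis.
by rewrite mulr_ge0 ?subr_ge0 // gd.
Qed.

(* [t] is the infimum of the slopes (L eta - m) / (x - eta), 0 <= eta < x. *)
Definition is_slope L x m t : Prop :=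
  (forall eta, 0 <= eta -> eta < x -> t * (x - eta) <= L eta - m) /\
  (forall e, 0 < e -> exists2 eta, 0 <= eta < x & L eta - m < (t + e) * (x - eta)).

Lemma slope_exists L x m : 0 < x ->
  (forall eta, 0 <= eta -> eta < x -> m <= L eta) -> exists t, is_slope L x m t.
Proof.
move=> x0 mL.
pose A := [set (L eta - m) / (x - eta) | eta in `[0, x[].
have A0 : A !=set0.
  by exists ((L 0 - m) / (x - 0)); exists 0 => //=; rewrite in_itv /= lexx.
have Al : has_lbound A.
  exists 0 => _ /= [eta + <-]; rewrite /= in_itv /= => /andP[e0 ex].
  by rewrite divr_ge0 // subr_ge0 ?mL // ltW.
exists (inf A); split => [eta e0 ex | e epos].
  rewrite -ler_pdivlMr ?subr_gt0 //; apply: ge_inf => //.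
  by exists eta => //=; rewrite in_itv /= e0.
have [_ [eta + <-]] := inf_adherent epos (conj A0 Al).
rewrite /= in_itv /= => etaP; exists eta => //.
by rewrite -ltr_pdivrMr // subr_gt0; case/andP: etaP.
Qed.

Lemma slope_ge0 L x m t : (forall eta, 0 <= eta -> eta < x -> m <= L eta) ->
  is_slope L x m t -> 0 <= t.
Proof.
move=> mL [_ tP]; rewrite leNgt; apply/negP => t0.
have [|eta /andP[e0 ex]] := tP (- t); first by rewrite oppr_gt0.
by rewrite subrr mul0r ltNge subr_ge0 mL.
Qed.

Lemma slope_le L x m m' t t' : is_slope L x m t -> is_slope L x m' t' ->
  m <= m' -> t' <= t.
Proof.
move=> [_ tP] [t'P _] mm; rewrite leNgt; apply/negP => tt.
have [|eta /andP[e0 ex]] := tP (t' - t); first by rewrite subr_gt0.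
rewrite (addrC t) subrK ltNge => /negP; apply; apply: (le_trans (t'P _ e0 ex)).
by rewrite lerD2l lerN2.
Qed.

Lemma slope_unique L x m t t' : is_slope L x m t -> is_slope L x m t' -> t = t'.
Proof.
by move=> h h'; apply/eqP; rewrite eq_le (slope_le h h') ?(slope_le h' h).
Qed.

(** * The greatest convex minorant with prescribed right end value *)

Section hull_extension.
Variables (L : R -> R) (c M : R).
Hypotheses (c0 : 0 < c) (M0 : 0 <= M)
  (Ld : forall x y, 0 <= x -> x <= y -> y <= c -> L y <= L x)
  (ML : M <= L c) (Lcont : L x @[x --> 0^'+] --> L 0).

(** The pair codes the line [p.1 - p.2 * x]; with this sign the second component compares directly
    with values of an estimator, which are minus the slopes. *)
Let line (p : R * R) : Prop :=
  (forall eta, 0 <= eta -> eta < c -> p.1 - p.2 * eta <= L eta) /\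
  p.1 - p.2 * c <= M.

(* The greatest convex function below L on [0, c[ and below M at c. *)
Let H x : R := sup [set p.1 - p.2 * x | p in line].

Let line_le p x : line p -> 0 <= x -> x <= c -> p.1 - p.2 * x <= L x.
Proof.
move=> [p1 p2] x0; rewrite le_eqVlt => /predU1P[->|]; last exact: p1.
exact: le_trans ML.
Qed.

Let const_line : line (M, 0).
Proof.
split => [eta e0 ec|] /=; rewrite mul0r subr0 //.
by apply: (le_trans ML); apply: Ld => //; exact: ltW.
Qed.

Let has_supH x : 0 <= x -> x <= c -> has_sup [set p.1 - p.2 * x | p in line].
Proof.
move=> x0 xc; split; first by eexists; exists (M, 0).
by exists (L x) => _ [p lp <-]; exact: line_le.
Qed.

Let line_leH p x : line p -> 0 <= x -> x <= c -> p.1 - p.2 * x <= H x.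
Proof.
move=> lp x0 xc; apply: ub_le_sup; last by exists p.
by case: (has_supH x0 xc).
Qed.

Let H_le x k : 0 <= x -> x <= c -> (forall p, line p -> p.1 - p.2 * x <= k) ->
  H x <= k.
Proof.
move=> x0 xc h; apply: ge_sup; first by case: (has_supH x0 xc).
by move=> _ [p lp <-]; exact: h.
Qed.

Let H_leL x : 0 <= x -> x <= c -> H x <= L x.
Proof. by move=> x0 xc; apply: H_le => // p lp; exact: line_le. Qed.

Let H_c : H c = M.
Proof.
apply/eqP; rewrite eq_le H_le //; [|exact: ltW|by move=> p []].
by have := line_leH const_line (ltW c0) (lexx c); rewrite /= mul0r subr0.
Qed.

Let H_leL' x eta : 0 <= eta -> eta < x -> x <= c -> H x <= L eta.
Proof.
move=> e0 ex xc; apply: (le_trans (H_leL (ltW (le_lt_trans e0 ex)) xc)).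
by apply: Ld => //; exact: ltW.
Qed.

Let slopeH_ex x : exists t, 0 < x -> x <= c -> is_slope L x (H x) t.
Proof.
have [x0|x0] := boolP (0 < x); last by exists 0 => x0'; case/negP: x0.
have [xc|xc] := boolP (x <= c); last by exists 0 => _ xc'; case/negP: xc.
have [|t tP] := @slope_exists L x (H x) x0; last by exists t.
by move=> eta e0 ex; exact: H_leL'.
Qed.

Let g x : R := projT1 (cid (slopeH_ex x)).

Let gP x : 0 < x -> x <= c -> is_slope L x (H x) (g x).
Proof. exact: (projT2 (cid (slopeH_ex x))). Qed.

(** A line nearly attaining [H y] that falls faster than [g y] already gives the bound at [x]; a
    flatter one is first tilted. *)
Let secl x y : 0 < x -> x < y -> y <= c -> g y * (y - x) <= H x - H y.
Proof.
move=> x0 xy yc; have y0 := lt_trans x0 xy.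
have [gl _] := gP y0 yc.
rewrite lerBrDr; apply/ler_addgt0Pr => e e0.
have [_ [p lp <-] pe] := sup_adherent e0 (has_supH (ltW y0) yc).
rewrite -/(H y) in pe.
have pH := line_leH lp (ltW y0) yc.
have [gp|pg] := leP p.2 (g y); last first.
  have := line_leH lp (ltW x0) (ltW (lt_le_trans xy yc)).
  have : g y * (y - x) <= p.2 * (y - x) by rewrite ler_wpM2r // ?subr_ge0 ltW.
  lra.
(* Turn [p] about its point over [y] to the slope [- g y]: left of [y] it stays below [L] because
   [g y] is the infimal slope, and right of [y] it only goes down. *)
have lq : line (p.1 - p.2 * y + g y * y, g y).
  have [lp1 lp2] := lp.
  split => [eta e0' ec|] /=.
    have [ey|ye] := ltP eta y; first by have := gl _ e0' ey; lra.
    have := lp1 _ e0' ec.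
    have : p.2 * (eta - y) <= g y * (eta - y) by rewrite ler_wpM2r // subr_ge0.
    lra.
  have : p.2 * (c - y) <= g y * (c - y) by rewrite ler_wpM2r // subr_ge0.
  lra.
have := line_leH lq (ltW x0) (ltW (lt_le_trans xy yc)) => /=; lra.
Qed.

(** By convexity, [H] at [x] lies below the chord from [(eta, L eta)] to [(y, H y)], where [eta]
    nearly attains the slope at [x]. *)
Let secr x y : 0 < x -> x < y -> y <= c -> H x - H y <= g x * (y - x).
Proof.
move=> x0 xy yc; have xc := ltW (lt_le_trans xy yc).
have y0 := lt_trans x0 xy.
have [_ ga] := gP x0 xc.
rewrite -ler_pdivrMr ?subr_gt0 //; apply/ler_addgt0Pr => e e0.
rewrite ler_pdivrMr ?subr_gt0 //.
have [eta /andP[eta0 etax] etaP] := ga _ e0.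
have conv : (y - eta) * H x <= (y - x) * L eta + (x - eta) * H y.
  rewrite mulrC -ler_pdivlMr ?subr_gt0; last exact: lt_trans xy.
  apply: H_le => //; [exact: ltW|move=> p lp].
  rewrite ler_pdivlMr ?subr_gt0; last exact: lt_trans xy.
  have h1 := line_le lp eta0 (ltW (lt_le_trans etax xc)).
  have h2 := line_leH lp (ltW y0) yc.
  have : (y - x) * (p.1 - p.2 * eta) <= (y - x) * L eta.
    by rewrite ler_wpM2l // subr_ge0 ltW.
  have : (x - eta) * (p.1 - p.2 * y) <= (x - eta) * H y.
    by rewrite ler_wpM2l // subr_ge0 ltW.
  lra.
have xe : 0 < x - eta by rewrite subr_gt0.
rewrite -(ler_pM2l xe).
have : (y - x) * (L eta - H x) <= (y - x) * ((g x + e) * (x - eta)).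
  by rewrite ler_wpM2l ?subr_ge0 // ltW.
lra.
Qed.

Let g_ge0 x : 0 < x -> x <= c -> 0 <= g x.
Proof.
by move=> x0 xc; apply: slope_ge0 (gP x0 xc) => eta e0 ex; exact: H_leL'.
Qed.

Let g_antitone x y : 0 < x -> x <= y -> y <= c -> g y <= g x.
Proof.
move=> x0; rewrite le_eqVlt => /predU1P[->//|xy yc].
have yx : 0 < y - x by rewrite subr_gt0.
rewrite -(ler_pM2r yx); exact: le_trans (secl x0 xy yc) (secr x0 xy yc).
Qed.

Let H_cvg : H x @[x --> 0^'+] --> L 0.
Proof.
have L0 : 0 <= L 0.
  by apply: (le_trans M0); apply: (le_trans ML); apply: Ld => //; exact: ltW.
apply/cvgrPdist_le => e e0.
have e20 : 0 < e / 2 by rewrite divr_gt0.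
have /cvgrPdist_le /(_ _ e20) [d' /= d'0 d'P] := Lcont.
pose d := Num.min d' c.
have d0 : 0 < d by rewrite /d lt_min d'0.
have dc : d <= c by rewrite /d ge_min lexx orbT.
(* This line starts [e / 2] below [L 0] and is already negative at [d]; continuity of [L] at [0]
   keeps it below [L] before that. *)
have lp : line (L 0 - e / 2, L 0 / d).
  split => [eta eta0 etac|] /=.
    have [ed|de] := ltP eta d.
      have : L 0 - e / 2 <= L eta.
        move: eta0; rewrite le_eqVlt => /predU1P[<-|eta0]; first lra.
        have := d'P eta; rewrite /= sub0r normrN gtr0_norm //.
        have ed' : eta < d' by apply: (lt_le_trans ed); rewrite /d ge_min lexx.
        by move=> /(_ ed' eta0); rewrite ler_norml; lra.
      have : 0 <= L 0 / d * eta by rewrite mulr_ge0 // divr_ge0 // ltW.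
      lra.
    have Lc : 0 <= L eta.
      by apply: (le_trans M0); apply: (le_trans ML); apply: Ld => //; exact: ltW.
    have : L 0 <= L 0 / d * eta.
      by rewrite -mulrA ler_peMr // mulrC ler_pdivlMr // mul1r.
    lra.
  have : L 0 <= L 0 / d * c by rewrite -mulrA ler_peMr // mulrC ler_pdivlMr // mul1r.
  have := M0; lra.
have Ld0 : 0 < L 0 / d + 1 by rewrite ltr_wpDl // divr_ge0 // ltW.
near=> x.
have x0 : 0 < x by near: x; exact: nbhs_right_gt.
have xc : x <= c by near: x; exact: nbhs_right_le.
have := line_leH lp (ltW x0) xc => /= h1.
have h2 := H_leL (ltW x0) xc.
have h3 := Ld (lexx 0) (ltW x0) xc.
have h4 : L 0 / d * x <= e / 2.
  have : x <= e / 2 / (L 0 / d + 1).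
    by near: x; apply: nbhs_right_le; rewrite divr_gt0.
  rewrite ler_pdivlMr // mulrC mulrDl mul1r => h; have := ltW x0; lra.
rewrite ler_norml; lra.
Unshelve. all: by end_near. Qed.

(** Here [M] is the mass already placed above [c]. The two secant bounds identify the integral of
    [g] with [H x - M] by [secant_itg], and [H_cvg] extends this down to [0]. *)
Lemma hull_extension : exists g,
  [/\ integ g 0 c, (forall x, 0 < x -> x <= c -> 0 <= g x),
      M + itg g 0 c = L 0,
      (forall x, 0 < x -> x <= c -> M + itg g x c <= L x) &
      (forall x, 0 < x -> x <= c -> is_slope L x (M + itg g x c) (g x))].
Proof.
have gE x : 0 < x -> x <= c -> itg g x c = H x - M.
  by move=> x0 xc; rewrite -H_c; exact: (secant_itg g_antitone secl secr).
have [gi gE0] : integ g 0 c /\ itg g 0 c = L 0 - M.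
  apply: (@itg_limit _ g (fun x => H x - M)) => //.
  - exact: antitone_measurable g_antitone.
  - by move=> x x0 xc; split; [exact: antitone_integ g_antitone x0|exact: gE].
  - by apply: cvgB; [exact: H_cvg|exact: cvg_cst].
exists g; split=> //; first by rewrite gE0 addrC subrK.
- by move=> x x0 xc; rewrite gE // addrC subrK; apply: H_leL => //; exact: ltW.
- by move=> x x0 xc; rewrite gE // addrC subrK; exact: gP.
Qed.

End hull_extension.
End hull.

(** * Optimality of the convex minorant *)

Section monotone_solution.
Context {R : realType}.
Local Notation mu := (@lebesgue_measure R).
Implicit Types (f g h phi D L : R -> R) (a b c x y u s e d k B M m t eta : R).

Section solution.
Variables (L g : R -> R) (c l : R).
Hypotheses (c0 : 0 < c) (gi : integ g 0 c).
(** With [l] the total mass, this is the mass above [x], expressed without reference to what lies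
    above [c]. *)
Let H x : R := l - itg g 0 x.
Hypothesis gslope : forall x, 0 < x -> x <= c -> is_slope L x (H x) (g x).

Let HB x y : 0 <= x -> x <= y -> y <= c -> H x - H y = itg g x y.
Proof.
move=> x0 xy yc; rewrite /H (itg_split x0 xy); last exact: integS gi.
ring.
Qed.

Let H_ucont : ucont H 0 c.
Proof.
have := ucontB (ucont_lin 0 l 0 c) (ucont_itg gi).
move=> h e e0; have [d d0 dP] := h e e0; exists d => // x y x0 xy yc xyd.
by have := dP x y x0 xy yc xyd; rewrite !mul0r !subr0.
Qed.

(** Suppose [g x < g y = t]. If [H x] is at most the height at [x] of the line of slope [- t]
    through [(y, H y)], all slopes from [x] are at least [t], which is absurd. Otherwise [H] ends
    below the line of slope [- t] through [(x, H x)]; but just after its last crossing with that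
    line [g] is at most [t], so [H] cannot drop below it. *)
Lemma slope_solution_antitone x y : 0 < x -> x <= y -> y <= c -> g y <= g x.
Proof.
move=> x0; rewrite le_eqVlt => /predU1P[->//|xy yc]; rewrite leNgt; apply/negP => gxy.
have y0 := lt_trans x0 xy; have xc := ltW (lt_le_trans xy yc).
set t := g y in gxy.
have [tL _] := gslope y0 yc; rewrite -/t in tL.
have [_ gL] := gslope x0 xc.
have [Hle|Hgt] := leP (H x) (H y + t * (y - x)).
  have [|eta /andP[e0 ex]] := gL (t - g x); first by rewrite subr_gt0.
  have := tL _ e0 (lt_trans ex xy); rewrite (addrC (g x)) subrK; lra.
(* This [eta] puts [L eta] more than [kap] below the line of slope [- t] through [(x, H x)], so
   slopes towards it from points less than [kap] below that line are at most [t]. *)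
have [|eta /andP[e0 ex] etaP] := gL ((t - g x) / 2); first by lra.
pose kap := (t - g x) / 2 * (x - eta).
have kap0 : 0 < kap by rewrite mulr_gt0 //; lra.
pose D u := H u - (H x + t * x - t * u).
have Dc : ucont D x y.
  apply: ucontB; last exact: ucont_lin.
  by apply: ucontS H_ucont => //; exact: ltW.
have Dx : 0 <= D x by rewrite /D; lra.
have Dy : D y < 0 by rewrite /D; lra.
have [s /andP[xs sy] [Ds DsP]] := last_crossing (ltW xy) Dc Dx Dy.
have [d d0 dP] := Dc _ kap0.
pose u := Num.min y (s + d / 2).
have su : s < u by rewrite /u lt_min sy /=; lra.
have uy : u <= y by rewrite /u ge_min lexx.
have usd : u <= s + d / 2 by rewrite /u ge_min lexx orbT.
clearbody u; have s0 : 0 < s by exact: lt_le_trans xs.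
have gt z : s < z -> z <= u -> g z <= t.
  move=> sz zu; have zc : z <= c by lra.
  have z0 : 0 < z by lra.
  have ez : eta < z by lra.
  have [/(_ _ e0 ez) h _] := gslope z0 zc.
  have := dP s z xs (ltW sz); rewrite ltr_norml => /(_ _ _)/andP[]; [lra|lra|].
  move=> Dsz _; rewrite -(ler_pM2r (_ : 0 < z - eta)) ?subr_gt0 //.
  apply: (le_trans h); move: Dsz Ds etaP; rewrite /D /kap; nra.
have Hsu : H s - H u <= t * (u - s).
  rewrite HB //; [|exact: ltW|exact: ltW|exact: le_trans yc].
  rewrite -itg_cst; last exact: ltW.
  apply: itg_le => //; last exact: integ_cst.
  by apply: integS gi; [exact: ltW|exact: le_trans yc].
have := DsP _ su uy; move: Ds; rewrite /D; lra.
Qed.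

Hypothesis g0 : forall x, 0 < x -> x <= c -> 0 <= g x.

(** * Comparison of second moments with a feasible competitor *)

Section competitor.
Variable phi : R -> R.
Hypotheses (phii : integ phi 0 c)
  (phiL : forall x, 0 < x -> x <= c -> l - itg phi 0 x <= L x)
  (phic : itg g 0 c <= itg phi 0 c).

(* Where g strictly drops, its primitive touches the constraint L. *)
Lemma itg_drop_le t s : 0 < t -> 0 < s -> s <= c ->
  (forall u, 0 < u -> u < s -> t <= g u) ->
  (forall u, s < u -> u <= c -> g u < t) -> itg g 0 s <= itg phi 0 s.
Proof.
move=> t0 s0; rewrite le_eqVlt => /predU1P[-> //|sc gt gs].
rewrite leNgt; apply/negP => lt_phi.
pose Phi x := l - itg phi 0 x.
have Pc : ucont Phi 0 c.
  have := ucontB (ucont_lin 0 l 0 c) (ucont_itg phii).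
  move=> h e e0; have [d d0 dP] := h e e0; exists d => // x y x0 xy yc xyd.
  by have := dP x y x0 xy yc xyd; rewrite !mul0r !subr0.
pose kap := (Phi s - H s) / 2.
have kap0 : 0 < kap by rewrite /kap /Phi /H; lra.
have [d d0 dP] := Pc _ kap0.
(* Within [d1] of [s] the function [Phi] moves by less than [kap], and over a length [2 * d1] a line
   of slope [- t] moves by at most [kap / 2]. *)
pose d1 := Num.min (Num.min (d / 2) (s / 2)) (kap / 4 / t).
have d10 : 0 < d1.
  by rewrite /d1 !lt_min (divr_gt0 d0) // (divr_gt0 s0) // divr_gt0 // divr_gt0.
have [d1d d1s d1k] : [/\ d1 <= d / 2, d1 <= s / 2 & d1 <= kap / 4 / t].
  by rewrite /d1; split; rewrite !ge_min lexx ?orbT.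
have td1 : t * d1 <= kap / 4.
  by move: d1k; rewrite ler_pdivlMr // mulrC.
clearbody d1.
pose u := Num.min c (s + d1).
have su : s < u by rewrite /u lt_min sc /=; lra.
have uc : u <= c by rewrite /u ge_min lexx.
have usd : u <= s + d1 by rewrite /u ge_min lexx orbT.
clearbody u; have u0 := lt_trans s0 su.
have gut := gs _ su uc.
have gu0 := g0 u0 uc.
(* The bound holds at each [z] in []eta, s[] in place of [s], since [g z >= t]; let [z] increase to
   [s]. *)
have HL eta : 0 <= eta -> eta < s -> t * (s - eta) <= L eta - H s.
  move=> e0 es; rewrite lerBrDr; apply/ler_addgt0Pr => e epos.
  have e2 : 0 < e / 2 by rewrite divr_gt0.
  have [d' d'0 d'P] := H_ucont e2.
  pose z := Num.max (Num.max (s / 2) (s - d' / 2))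
    (Num.max ((s + eta) / 2) (s - e / (2 * t))).
  have zs : z < s.
    rewrite /z !gt_max !ltrBlDr !ltrDl !divr_gt0 ?mulr_gt0 //=.
    by apply/andP; split; [|apply/andP; split]; lra.
  have [z1 z2 z3 z4] : [/\ s / 2 <= z, s - d' / 2 <= z, (s + eta) / 2 <= z &
      s - e / (2 * t) <= z].
    by rewrite /z; split; rewrite !le_max lexx ?orbT.
  clearbody z; have z0 : 0 < z by lra.
  have ez : eta < z by lra.
  have [/(_ _ e0 ez) h _] := gslope z0 (ltW (lt_trans zs sc)).
  have gz := gt _ z0 zs.
  have := d'P z s (ltW z0) (ltW zs) (ltW sc); rewrite ltr_norml.
  move=> /(_ _)/andP[]; first by lra.
  move=> h1 h2.
  have h3 : t * (z - eta) <= g z * (z - eta) by rewrite ler_wpM2r // subr_ge0 ltW.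
  have h4 : t * (s - z) <= e / 2.
    have : s - z <= e / (2 * t) by lra.
    rewrite -(ler_pM2l t0) => /le_trans; apply; rewrite le_eqVlt; apply/orP; left.
    by apply/eqP; field; rewrite gt_eqF.
  lra.
have HHsu : g u * (u - s) <= H s - H u.
  rewrite HB //; [|exact: ltW|exact: ltW]; rewrite -itg_cst; last exact: ltW.
  apply: itg_le; [exact: integ_cst|by apply: integS gi; [exact: ltW|]|].
  move=> x sx xu; apply: slope_solution_antitone => //; exact: lt_trans sx.
have HHsu' : H u <= H s.
  have : 0 <= g u * (u - s) by rewrite mulr_ge0 // subr_ge0 ltW.
  lra.
have c1 : 0 < c + 1 by lra.
(* This [e] keeps [g u + e] at most [t] and is too small to make up the surplus [(t - g u) * d1]
   that [HL] yields for [eta < s - d1]. *)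
pose e := Num.min (t - g u) ((t - g u) * d1 / (c + 1)).
have e0 : 0 < e by rewrite /e lt_min subr_gt0 gut /= divr_gt0 // mulr_gt0 // subr_gt0.
have et : g u + e <= t by rewrite -lerBrDl /e ge_min lexx.
have ed : e * (c + 1) <= (t - g u) * d1 by rewrite -ler_pdivlMr // /e ge_min lexx orbT.
clearbody e; have [_ /(_ _ e0) [eta /andP[eta0 etau] etaP]] := gslope u0 uc.
(* A near-optimal [eta] close to [s] forces [L eta < Phi eta], against [phiL]; one further left is
   excluded by [HL]. *)
have [es|se] := ltP eta (s - d1); last first.
  have eta0' : 0 < eta by lra.
  have etac : eta <= c by lra.
  have h1 : H s + kap <= Phi eta.
    have [es|se'] := leP eta s.
      have := dP eta s eta0 es (ltW sc); rewrite ltr_norml => /(_ _)/andP[]; first by lra.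
      rewrite /kap; lra.
    have := dP s eta (ltW s0) (ltW se') etac; rewrite ltr_norml.
    move=> /(_ _)/andP[]; first by lra.
    rewrite /kap; lra.
  have h2 := phiL eta0' etac.
  have h3 : (g u + e) * (u - eta) <= t * (u - eta) by rewrite ler_wpM2r // subr_ge0 ltW.
  have h4 : t * (u - eta) <= t * (d1 + d1) by rewrite ler_pM2l //; lra.
  rewrite /Phi in h1; lra.
have h1 := HL _ eta0 (lt_trans es (_ : s - d1 < s)).
have {}h1 := h1 ltac:(lra).
have h2 : (t - g u) * d1 <= (t - g u) * (s - eta).
  by rewrite ler_wpM2l // ?subr_ge0; lra.
have h3 : e * (u - eta) < e * (c + 1) by rewrite ltr_pM2l //; lra.
lra.
Qed.

Let ind t x : R := if t <= g x then 1 else 0.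

Let ind_measurable t : measurable_fun (`]0, c]%classic : set R) (ind t).
Proof.
apply: antitone_measurable => x y x0 xy yc; rewrite /ind.
have gxy := slope_solution_antitone x0 xy yc.
case: ifPn => [ty|_]; first by rewrite (le_trans ty).
by case: ifP.
Qed.

Let ind_integ t h : integ h 0 c -> integ (fun x => ind t x * h x) 0 c.
Proof.
apply: (@integ_Mbounded _ _ _ _ _ 1) => // x _ _; rewrite /ind.
by case: ifP; rewrite ?normr1 ?normr0.
Qed.

(** By monotonicity the superlevel set of [g] is an interval from [0] to its supremum [s], where
    [itg_drop_le] applies; whether [s] belongs to it does not affect the integral. *)
Let itg_ind_ge0 t : 0 < t -> 0 <= itg (fun x => ind t x * (phi x - g x)) 0 c.
Proof.
move=> t0.
have di := integB phii gi.
pose A := [set x | [/\ 0 < x, x <= c & t <= g x]].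
have [A0|A0] := pselect (A !=set0); last first.
  rewrite (@eq_itg _ _ (fun=> 0)) ?itg_cst ?mul0r //; first exact: ltW.
  move=> x x0 xc; rewrite /ind; case: ifPn => [tg|_]; last by rewrite mul0r.
  by case: A0; exists x.
have As : has_sup A by split => //; exists c => x [].
set s := sup A.
have sc : s <= c by apply: ge_sup => // x [].
have s0 : 0 < s.
  case: A0 => x [x0 xc tg]; apply: (lt_le_trans x0); apply: ub_le_sup.
    by case: As.
  by split.
have above u : s < u -> u <= c -> g u < t.
  move=> su uc; rewrite ltNge; apply/negP => tg.
  have : u <= s by apply: ub_le_sup; [case: As|split => //; exact: lt_trans su].
  by rewrite leNgt su.
have below u : 0 < u -> u < s -> t <= g u.
  move=> u0 us; have [] := @sup_adherent _ A (s - u) _ As.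
    by rewrite subr_gt0.
  move=> z [z0 zc tz]; rewrite -/s subKr => uz.
  by apply: (le_trans tz); apply: slope_solution_antitone => //; exact: ltW.
rewrite (itg_split (ltW s0) sc (ind_integ _ di)).
rewrite [X in _ + X](@eq_itg _ _ (fun=> 0)); last first.
  by move=> x sx xc; rewrite /ind leNgt above // mul0r.
rewrite itg_cst // mul0r addr0.
rewrite (@eq_itg_open _ _ (fun x => phi x - g x)).
- rewrite itgB ?subr_ge0; first exact: (@itg_drop_le t).
  + exact: integS phii.
  + exact: integS gi.
- by apply: integS (ind_integ _ di).
- exact: integS di.
- by move=> x x0 xs; rewrite /ind below // mul1r.
Qed.

(** A discrete layer cake: for [d > 0] and [g x >= 0] it lies at most [d] below the minimum of [g x]
    and [d * K], while being a positive combination of superlevel indicators. *)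
Let step d K x : R := \sum_(k < K) d * ind (d * k.+1%:R) x.

Let step_measurable d K : measurable_fun (`]0, c]%classic : set R) (step d K).
Proof.
elim: K => [|K IH].
  rewrite (_ : step d 0 = fun=> 0); last by apply/funext => x; rewrite /step big_ord0.
  exact: measurable_cst.
rewrite (_ : step d K.+1 = fun x => step d K x + d * ind (d * K.+1%:R) x); last first.
  by apply/funext => x; rewrite /step big_ord_recr.
by apply: measurable_funD => //; apply: measurable_funM.
Qed.

Let step_full d K x : 0 < d -> d * K%:R <= g x -> step d K x = d * K%:R.
Proof.
move=> d0 dK; rewrite /step (eq_bigr (fun=> d)).
  by rewrite sumr_const card_ord mulr_natr.
move=> k _; rewrite /ind ifT ?mulr1 //; apply: le_trans dK.
by rewrite ler_pM2l // ler_nat.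
Qed.

Let step_bounds d K x : 0 < d -> 0 <= g x ->
  [/\ 0 <= step d K x, step d K x <= Num.min (g x) (d * K%:R) &
      Num.min (g x) (d * K%:R) - d <= step d K x].
Proof.
move=> d0 gx; elim: K => [|K [h1 h2 h3]].
  by rewrite /step big_ord0 mulr0 min_r // lexx; split=> //; lra.
have [gK|Kg] := leP (d * K.+1%:R) (g x).
  rewrite step_full // lexx; split=> //; last by rewrite gerBl ltW.
  by apply: mulr_ge0 => //; exact: ltW.
have -> : step d K.+1 x = step d K x.
  by rewrite /step big_ord_recr /= [X in _ + _ * X]/ind ifN -?ltNge // mulr0 addr0.
move: h2; rewrite le_min => /andP[h2 h2']; split => //.
have [gK|Kg'] := leP (d * K%:R) (g x).
  rewrite step_full //; move: Kg; rewrite -natr1 mulrDr mulr1; lra.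
by move: h3; rewrite min_l // ltW.
Qed.

Let step_integ d K h : 0 < d -> integ h 0 c -> integ (fun x => step d K x * h x) 0 c.
Proof.
move=> d0; apply: (@integ_Mbounded _ _ _ _ _ (d * K%:R)) => // x x0 xc.
have [h1 h2 _] := step_bounds K d0 (g0 x0 xc).
rewrite ger0_norm // (le_trans h2) // ge_min lexx orbT //.
Qed.

Let itg_step_ge0 d K : 0 < d -> 0 <= itg (fun x => step d K x * (phi x - g x)) 0 c.
Proof.
move=> d0; have di := integB phii gi; elim: K => [|K IH].
  rewrite (@eq_itg _ _ (fun=> 0)) ?itg_cst ?mul0r //; first exact: ltW.
  by move=> x _ _; rewrite /step big_ord0 mul0r.
rewrite (@eq_itg _ _ (fun x => step d K x * (phi x - g x) +
    d * (ind (d * K.+1%:R) x * (phi x - g x)))); last first.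
  by move=> x _ _; rewrite /step big_ord_recr /=; ring.
rewrite itgD; [|exact: step_integ|exact/integZ/ind_integ].
rewrite addr_ge0 // itgZ; last exact: ind_integ.
by apply: mulr_ge0; [exact: ltW|apply: itg_ind_ge0; rewrite mulr_gt0].
Qed.

Hypothesis phi2i : integ (fun x => phi x ^+ 2) 0 c.

Let g_measurable : measurable_fun (`]0, c]%classic : set R) g.
Proof. exact: integ_measurable gi. Qed.

Let gN2_integ N : 0 <= N -> integ (fun x => Num.min (g x) N ^+ 2) 0 c.
Proof.
move=> N0; apply: (@integ_le _ _ (fun=> N ^+ 2)); last exact: integ_cst.
  by apply: measurable_funX; apply: measurable_minr => //; exact: measurable_cst.
move=> x x0 xc; rewrite ger0_norm ?sqr_ge0 //.
rewrite ler_sqr ?nnegrE ?ge_min ?lexx ?orbT //.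
by rewrite le_min g0.
Qed.

(** With [m] the minimum of [g] and [N], integrate [2 * step * (phi - g) <= phi ^+ 2 - m ^+ 2 + 2 *
    d * g]: the left side has nonnegative integral and the error vanishes with [d]. The truncation
    is there because [g ^+ 2] is not yet known to be integrable. *)
Let itg_gN2_le N : 0 < N ->
  itg (fun x => Num.min (g x) N ^+ 2) 0 c <= itg (fun x => phi x ^+ 2) 0 c.
Proof.
move=> N0; apply/ler_addgt0Pr => e e0.
have ig0 : 0 <= itg g 0 c by apply: itg_ge0 => x; exact: g0.
(* Chosen so that [d = N / K] makes the error term [2 * d * itg g 0 c] at most [e]. *)
pose K := (Num.bound (2 * N * itg g 0 c / e)).+1.
pose d := N / K%:R.
have K0 : 0 < K%:R :> R by rewrite ltr0n.
have d0 : 0 < d by rewrite divr_gt0.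
have dK : d * K%:R = N by rewrite /d divfK // gt_eqF.
have de : 2 * d * itg g 0 c <= e.
  have : 2 * N * itg g 0 c / e <= K%:R.
    apply: (@le_trans _ _ (Num.bound (2 * N * itg g 0 c / e))%:R).
      by apply/ltW/archi_boundP; rewrite divr_ge0 ?mulr_ge0 // ltW.
    by rewrite ler_nat.
  rewrite ler_pdivrMr // -dK => h.
  rewrite -(ler_pM2r K0); lra.
have h1 : 0 <= itg (fun x => phi x ^+ 2 - Num.min (g x) N ^+ 2 + 2 * d * g x) 0 c.
  apply: (@le_trans _ _ (itg (fun x => 2 * (step d K x * (phi x - g x))) 0 c)).
    rewrite itgZ; last exact/step_integ/integB.
    by apply: mulr_ge0 => //; exact: itg_step_ge0.
  apply: itg_le.
  - exact/integZ/step_integ/integB.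
  - by apply: integD; [apply: integB => //; apply: gN2_integ; exact: ltW|exact: integZ].
  move=> x x0 xc; have gx := g0 x0 xc.
  have [s1 s2 s3] := step_bounds K d0 gx; rewrite dK in s2 s3.
  have mg : Num.min (g x) N <= g x by rewrite ge_min lexx.
  have m0 : 0 <= Num.min (g x) N by rewrite le_min gx ltW.
  set st := step d K x in s1 s2 s3 *; set m := Num.min _ _ in s2 s3 mg m0 *.
  have q1 : 2 * (st * phi x) <= m ^+ 2 + phi x ^+ 2.
    have : st ^+ 2 <= m ^+ 2 by rewrite ler_sqr ?nnegrE.
    have : 0 <= (st - phi x) ^+ 2 by exact: sqr_ge0.
    rewrite sqrrB; lra.
  have q2 : (m - d) * g x <= st * g x by rewrite ler_wpM2r.
  have q3 : m * m <= m * g x by rewrite ler_wpM2l.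
  rewrite expr2 in q1; rewrite (expr2 m); lra.
rewrite itgD in h1; [|apply: integB => //; apply: gN2_integ; exact: ltW|exact: integZ].
rewrite itgB // in h1; last by apply: gN2_integ; exact: ltW.
rewrite itgZ // in h1; lra.
Qed.

(** On []x, c]] monotonicity gives [g <= g x], so truncating at [g x + 1] changes nothing; the bound
    is uniform in [x], and [itg_bounded] carries it down to [0]. *)
Lemma slope_solution_min_norm : integ (fun x => g x ^+ 2) 0 c /\
  itg (fun x => g x ^+ 2) 0 c <= itg (fun x => phi x ^+ 2) 0 c.
Proof.
apply: itg_bounded => //; first exact: measurable_funX.
- by move=> x _ _; exact: sqr_ge0.
- move=> x x0 xc; apply: (@antitone_integ _ _ 0) => // y z y0 yz zc.
  have y0' := lt_le_trans y0 yz.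
  by rewrite ler_sqr ?nnegrE ?g0 ?slope_solution_antitone // (le_trans yz).
move=> x x0 xc.
pose N := g x + 1; have N0 : 0 < N by rewrite ltr_wpDl // g0.
apply: le_trans (itg_gN2_le N0).
have gNi := gN2_integ (ltW N0).
rewrite (itg_split (ltW x0) xc gNi).
rewrite (@eq_itg _ _ (fun u => Num.min (g u) N ^+ 2) x) ?lerDr.
  by apply: itg_ge0 => u _ _; exact: sqr_ge0.
move=> u xu uc; rewrite min_l //.
have := slope_solution_antitone x0 (ltW xu) uc; rewrite /N; lra.
Qed.

End competitor.

Hypothesis HL : forall x, 0 < x -> x <= c -> l - itg g 0 x <= L x.

(** The mean [p] of [g] and [h] is again feasible, so its second moment is at least that of [g]; the
    identity [q = 4 * ((h ^+ 2 + g ^+ 2) / 2 - p ^+ 2)] then makes the integral of [q]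
    nonpositive. *)
Lemma slope_solution_unique h : integ h 0 c ->
  (forall x, 0 < x -> x <= c -> l - itg h 0 x <= L x) ->
  itg g 0 c = itg h 0 c ->
  integ (fun x => h x ^+ 2) 0 c -> integ (fun x => g x ^+ 2) 0 c ->
  itg (fun x => h x ^+ 2) 0 c <= itg (fun x => g x ^+ 2) 0 c ->
  {ae mu, forall x, 0 < x <= c -> h x = g x}.
Proof.
move=> hi hL hc h2 g2 hg.
have mh := integ_measurable hi; have mg := integ_measurable gi.
pose p x := 2^-1 * (h x + g x); pose q x := (h x - g x) ^+ 2.
have pi_ : integ p 0 c by apply: integZ; exact: integD.
have pE x : x <= c -> 0 < x -> itg p 0 x = 2^-1 * (itg h 0 x + itg g 0 x).
  move=> xc x0; rewrite /p itgZ ?itgD //.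
  - exact: integS hi.
  - exact: integS gi.
  - by apply: integD; [exact: integS hi|exact: integS gi].
have s2 : integ (fun x => 2^-1 * (h x ^+ 2 + g x ^+ 2)) 0 c.
  by apply: integZ; exact: integD.
have p2i : integ (fun x => p x ^+ 2) 0 c.
  apply: (integ_le _ _ s2).
    by apply: measurable_funX; apply: measurable_funM => //; exact: measurable_funD.
  move=> x _ _; rewrite ger0_norm ?sqr_ge0 // /p.
  have := sqr_ge0 (h x - g x); rewrite sqrrB exprMn sqrrD; lra.
have qi : integ q 0 c.
  apply: (integ_le _ _ (integZ 4 s2)).
    by apply: measurable_funX; exact: measurable_funB.
  move=> x _ _; rewrite ger0_norm ?sqr_ge0 // /q.
  have := sqr_ge0 (h x + g x); rewrite sqrrB sqrrD; lra.
have [||_ pg] := slope_solution_min_norm pi_ _ _ p2i.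
- move=> x x0 xc; rewrite pE //; have := hL x x0 xc; have := HL x0 xc; lra.
- by rewrite pE // hc; lra.
have q0 : itg q 0 c <= 0.
  have : itg q 0 c = itg (fun x => 4 * (2^-1 * (h x ^+ 2 + g x ^+ 2) - p x ^+ 2)) 0 c.
    by apply: eq_itg => x _ _; rewrite /q /p exprMn sqrrB sqrrD; field.
  rewrite itgZ; last exact: integB.
  rewrite itgB // itgZ ?itgD //; last exact: integD.
  lra.
have q0' : itg q 0 c = 0.
  by apply/eqP; rewrite eq_le q0 itg_ge0 // => x _ _; exact: sqr_ge0.
have := itg_eq0_ae qi (fun x => sqr_ge0 _) q0'.
by apply: ae_imp => x qx /qx /eqP; rewrite sqrf_eq0 subr_eq0 => /eqP.
Qed.
End solution.
End monotone_solution.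

(** * Monotone sampling *)

Section scheme.
Context {R : realType} {V : Type}.
Local Notation mu := (@lebesgue_measure R).
Variables (S : sampling_scheme R V) (f : V -> R).
Hypothesis f_ge0 : forall v, 0 <= f v.
Hypothesis H1 : forall v, lower_bound S f u v @[u --> 0^'+] --> f v.
Implicit Types (v w z : V) (u x rho c : R) (e h : R * set V -> R).

Let L v u := lower_bound S f u v.

(** Vectors indistinguishable at [u] remain so at larger seeds: monotonicity moves [v] into [S x y],
    where consistency applies. *)
Lemma sstar_eq u x y v : 0 < u -> u <= x -> x <= 1 -> S u y v -> S x v = S x y.
Proof.
move=> u0 ux x1 yv; apply: sstar_consistent; first by rewrite x1 (lt_le_trans u0).
exact: (sstar_mono u0 ux x1).
Qed.

Lemma lower_bound0 v : L v 0 = f v.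
Proof.
rewrite /L /lower_bound eqxx; apply/cvg_lim => //.
apply/cvgrPdist_le => e e0; have /cvgrPdist_le /(_ _ e0) h := @H1 v.
near=> u; have : `|f v - lower_bound S f u v| <= e by near: u.
rewrite /lower_bound gt_eqF //; near: u; exact: nbhs_right_gt.
Unshelve. all: by end_near. Qed.

Lemma lower_bound_eq u x y v : 0 < u -> u <= x -> x <= 1 -> S u y v -> L v x = L y x.
Proof.
move=> u0 ux x1 yv; rewrite /L /lower_bound gt_eqF ?(lt_le_trans u0) //.
by rewrite /lower_bound_seed (sstar_eq u0 ux x1 yv).
Qed.

Lemma est_at_eq e u x y v : 0 < u -> u <= x -> x <= 1 -> S u y v ->
  est_at S e x v = est_at S e x y.
Proof. by move=> u0 ux x1 yv; rewrite /est_at /outcome (sstar_eq u0 ux x1 yv). Qed.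

(** The lower bounds of [v] and [z] coincide at all seeds, hence so do their limits at [0]. *)
Lemma sstar_all_eq v z : (forall u, 0 < u -> u <= 1 -> S u v z) -> f z = f v.
Proof.
move=> vz; apply/eqP; rewrite -subr_eq0 -normr_le0; apply/ler_addgt0Pr => e e0.
have e2 : 0 < e / 2 by rewrite divr_gt0.
have /cvgrPdist_le /(_ _ e2) hv := @H1 v; have /cvgrPdist_le /(_ _ e2) hz := @H1 z.
have [d /= d0 dP] := hv; have [d' /= d'0 d'P] := hz.
pose u := Num.min (Num.min (d / 2) (d' / 2)) 1.
have u0 : 0 < u by rewrite /u !lt_min !divr_gt0 // ltr01.
have [ud ud' u1] : [/\ u <= d / 2, u <= d' / 2 & u <= 1].
  by rewrite /u; split; rewrite !ge_min lexx ?orbT.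
have := dP u; have := d'P u; rewrite /= sub0r normrN gtr0_norm //.
rewrite -/(L z u) -/(L v u) (lower_bound_eq u0 (lexx u) u1 (vz _ u0 u1)).
move=> /(_ _ u0) h' /(_ _ u0) h; move: h' h; rewrite !ler_norml.
move=> /(_ _)/andP[|? ?]; first lra.
by move=> /(_ _)/andP[|? ?]; [lra|apply/andP; split; lra].
Qed.

Lemma lower_bound_le u v z : 0 < u -> u <= 1 -> S u v z -> L v u <= f z.
Proof.
move=> u0 u1 vz; rewrite /L /lower_bound gt_eqF //.
by apply: ge_inf; [exists 0 => _ [w _ <-]|exists z].
Qed.

Lemma lower_bound_ge u v k : 0 < u -> u <= 1 -> (forall z, S u v z -> k <= f z) ->
  k <= L v u.
Proof.
move=> u0 u1 kf; rewrite /L /lower_bound gt_eqF //.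
apply: lb_le_inf; last by move=> _ [z vz <-]; exact: kf.
by exists (f v), v => //; apply: sstar_refl; rewrite u0.
Qed.

Lemma lower_bound_anti v x y : 0 <= x -> x <= y -> y <= 1 -> L v y <= L v x.
Proof.
rewrite le_eqVlt => /predU1P[<-|x0] xy y1.
  rewrite lower_bound0; have := xy; rewrite le_eqVlt => /predU1P[<-|y0].
    by rewrite lower_bound0.
  by apply: lower_bound_le => //; apply: sstar_refl; rewrite y0.
apply: lower_bound_ge => //; first exact: le_trans y1.
move=> z vz; apply: lower_bound_le => //; first exact: lt_le_trans xy.
exact: (sstar_mono x0 xy y1).
Qed.

Lemma lower_bound_ge0 v x : 0 <= x -> x <= 1 -> 0 <= L v x.
Proof.
rewrite le_eqVlt => /predU1P[<- _|x0 x1]; first by rewrite lower_bound0.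
exact: lower_bound_ge.
Qed.

Lemma nonneg_unbiased_itg e v : nonneg_unbiased S f e ->
  [/\ integ (fun u => est_at S e u v) 0 1,
      (forall u, 0 < u -> u <= 1 -> 0 <= est_at S e u v) &
      itg (fun u => est_at S e u v) 0 1 = f v].
Proof.
move=> [ei e0 eu]; split; [exact: ei| |exact: eu].
by move=> u u0 u1; apply: e0; rewrite u0.
Qed.

(** Above [x] the estimator cannot distinguish [v] from any [z] in [S x v], and nonnegativity bounds
    that mass by the total [f z]. *)
Lemma nonneg_unbiased_itg_le e v x : nonneg_unbiased S f e -> 0 < x -> x <= 1 ->
  itg (fun u => est_at S e u v) x 1 <= L v x.
Proof.
move=> eP x0 x1; apply: lower_bound_ge => // z vz.
have [ei e0 <-] := nonneg_unbiased_itg z eP.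
rewrite (itg_split (ltW x0) x1 ei).
rewrite (@eq_itg _ _ (fun u => est_at S e u z) x 1).
  by rewrite lerDr; apply: itg_ge0 => u u0 ux; apply: e0 => //; exact: le_trans x1.
by move=> u xu u1; rewrite (est_at_eq e x0 (ltW xu) u1 vz).
Qed.

Lemma inf_slopeE rho z x t : 0 < rho -> is_slope (L z) rho x t ->
  inf_slope S f rho z x = t%:E.
Proof.
move=> r0 [tl ta]; apply/eqP; rewrite eq_le; apply/andP; split; last first.
  apply: le_ereal_inf_tmp => _ [eta + <-]; rewrite /= in_itv /= => /andP[e0 er].
  by rewrite lee_fin ler_pdivlMr ?subr_gt0 // tl.
apply/lee_addgt0Pr => e e0; have [eta /andP[eta0 etar] etaP] := ta e e0.
apply: (@le_trans _ _ (((L z eta - x) / (rho - eta))%:E)).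
  by apply: ereal_inf_lbound; exists eta => //=; rewrite in_itv /= eta0.
by rewrite -EFinD lee_fin ler_pdivrMr ?subr_gt0 // ltW.
Qed.

Lemma slope_ex z rho x : 0 < rho -> rho <= 1 -> x <= L z rho ->
  exists t, is_slope (L z) rho x t.
Proof.
move=> r0 r1 xL; apply: slope_exists => // eta e0 er; apply: (le_trans xL).
by apply: lower_bound_anti => //; exact: ltW.
Qed.

(** * Minimal vectors and the solution along one data vector *)

Section order.
Variable prec : V -> V -> Prop.
Hypothesis H2 : forall (rho : R) (v : V) (x : R) (z w : V), 0 < rho <= 1 ->
  0 < x <= lower_bound S f rho v ->
  min_prec prec (S rho v) z -> min_prec prec (S rho v) w ->
  inf_slope S f rho z x = inf_slope S f rho w x.
Hypothesis H4 : forall v, exists2 F : set V, finite_set F &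
  forall u : R, 0 < u <= 1 -> exists2 z, F z & min_prec prec (S u v) z.

Let mini u v := min_prec prec (S u v).

Lemma min_prec_le u c v z : 0 < u -> u <= c -> c <= 1 -> mini c v z -> S u v z ->
  mini u v z.
Proof.
move=> u0 uc c1 [_ zmin] vz; split => // -[w vw wz]; apply: zmin; exists w => //.
exact: (sstar_mono u0 uc c1).
Qed.

(* At x = 0, a strict gap between two slopes at rho would persist at seeds
   slightly below rho with a positive x proportional to the distance. *)
Lemma slope0_le rho v z w t t' : 0 < rho -> rho <= 1 ->
  mini rho v z -> mini rho v w ->
  is_slope (L z) rho 0 t -> is_slope (L w) rho 0 t' -> t' <= t.
Proof.
move=> r0 r1 zmin wmin [_ za] [wl _]; rewrite leNgt; apply/negP => tt.
have [|eta /andP[eta0 etar]] := za (t' - t); first by rewrite subr_gt0.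
rewrite subr0 addrC subrK => etaP.
have t'0 : 0 < t'.
  have : 0 <= L z eta by apply: lower_bound_ge0 => //; lra.
  by move=> h; have := le_lt_trans h etaP; rewrite pmulr_lgt0 // subr_gt0.
have rr : 0 < rho <= 1 by rewrite r0.
have [e1 e10 zS] := sstar_left_open rr zmin.1.
have [e2 e20 wS] := sstar_left_open rr wmin.1.
(* Take [u] above the witness [eta] and so close to [rho] that [z] and [w] are still consistent with
   [v]. *)
have [u [ur u0 uz uw ue]] : exists u,
    [/\ u < rho, 0 < u, rho - e1 < u, rho - e2 < u & eta < u].
  exists (Num.max (Num.max (rho / 2) ((rho + eta) / 2))
    (Num.max (rho - e1 / 2) (rho - e2 / 2))).
  by rewrite !gt_max !lt_max; split; do ?[apply/andP; split]; try lra;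
     apply/orP; do ?[by left; apply/orP; (left; lra) || (right; lra)];
     right; apply/orP; (left; lra) || (right; lra).
have u1 : u <= 1 by lra.
have uu : 0 < u <= 1 by rewrite u0.
have vz := zS u uz uu; have vw := wS u uw uu.
have zu : mini u v z by exact: (min_prec_le u0 (ltW ur) r1 zmin).
have wu : mini u v w by exact: (min_prec_le u0 (ltW ur) r1 wmin).
(* The height at [u] of the line of slope [- t'] that vanishes at [rho]: [L z eta] lies below that
   line, while [L w] stays above it. *)
pose x := t' * (rho - u).
have x0 : 0 < x by rewrite mulr_gt0 // subr_gt0.
have Lw : L w u = L v u by exact: (lower_bound_eq u0 (lexx u)).
have Lz : L z u = L v u by exact: (lower_bound_eq u0 (lexx u)).
have xLw : x <= L w u by have := wl u (ltW u0) ur; rewrite subr0.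
have xLv : 0 < x <= lower_bound S f u v by rewrite x0 -/(L v u) -Lw.
have xLz : x <= L z u by rewrite Lz -Lw.
have [tz tzP] := slope_ex u0 u1 xLz.
have [tw twP] := slope_ex u0 u1 xLw.
have := H2 uu xLv zu wu; rewrite (inf_slopeE u0 tzP) (inf_slopeE u0 twP) => -[tzw].
have h1 := tzP.1 _ eta0 ue.
have : tz < t'.
  rewrite -(ltr_pM2r (_ : 0 < u - eta)) ?subr_gt0 //; apply: (le_lt_trans h1).
  rewrite /x; lra.
rewrite ltNge => /negP; apply; rewrite tzw leNgt; apply/negP => twt.
have [|k /andP[k0 ku]] := twP.2 (t' - tw); first by rewrite subr_gt0.
have := wl k k0 (lt_trans ku ur); rewrite (addrC tw) subrK /x; lra.
Qed.

(** [H2] covers positive [x]; when no mass lies above [rho], [slope0_le] in both directions takes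
    its place. *)
Lemma slope_min rho v x z w t : 0 < rho -> rho <= 1 -> 0 <= x -> x <= L v rho ->
  mini rho v z -> mini rho v w ->
  is_slope (L z) rho x t -> is_slope (L w) rho x t.
Proof.
move=> r0 r1 x0 xL zmin wmin zt.
have Lw : L w rho = L v rho by exact: (lower_bound_eq r0 (lexx _) r1 wmin.1).
have [|t' wt] := @slope_ex w rho x r0 r1; first by rewrite Lw.
suff -> : t = t' by [].
move: x0; rewrite le_eqVlt => /predU1P[x0|x0]; last first.
  have := @H2 rho v x z w; rewrite r0 r1 x0 => /(_ isT xL zmin wmin).
  by rewrite (inf_slopeE r0 zt) (inf_slopeE r0 wt) => -[].
rewrite -x0 in zt wt; apply/eqP; rewrite eq_le.
by rewrite (slope0_le r0 r1 wmin zmin wt zt) (slope0_le r0 r1 zmin wmin zt wt).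
Qed.

(** The invariant of a construction going down in the seed: the equation holds above [c] only, the
    bound at [c] itself is what a further extension starts from, and the total mass is fixed once
    [c = 0]. *)
Definition solution_above v c (G : R -> R) : Prop :=
  [/\ integ G 0 1, (forall u, 0 < u -> u <= 1 -> 0 <= G u), itg G c 1 <= L v c,
      (c = 0 -> itg G 0 1 = f v) &
      forall rho, c < rho -> rho <= 1 -> itg G rho 1 <= L v rho /\
        forall z, mini rho v z -> is_slope (L z) rho (itg G rho 1) (G rho)].

(** The seeds at which [z] is consistent with [v] are upward closed, and left-openness keeps their
    infimum out of them. *)
Lemma sstar_threshold c v z : 0 < c -> c <= 1 -> S c v z ->
  exists2 a, 0 <= a < c & (forall u, a < u -> u <= 1 -> S u v z) /\
    (forall u, 0 < u -> u <= a -> ~ S u v z).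
Proof.
move=> c0 c1 cz; pose A := [set u | 0 < u <= 1 /\ S u v z].
have cA : A c by split; rewrite ?c0.
have lA : has_lbound A by exists 0 => u [/andP[/ltW]].
have Aopen u : A u -> exists2 x, A x & x < u.
  move=> [u01 uz]; have [d d0 dP] := sstar_left_open u01 uz.
  case/andP: u01 => u0 u1.
  have [x [x0 xu xd]] : exists x, [/\ 0 < x, x < u & u - d < x].
    exists (Num.max (u / 2) (u - d / 2)); rewrite gt_max !lt_max.
    split; [|apply/andP; split|]; [apply/orP; left|..|apply/orP; right]; lra.
  have x01 : 0 < x <= 1 by apply/andP; split; lra.
  by exists x => //; split => //; exact: dP.
exists (inf A).
  apply/andP; split; first by apply: lb_le_inf; [exists c|move=> u [/andP[/ltW]]].
  by have [x Ax xc] := Aopen c cA; apply: le_lt_trans xc; exact: ge_inf.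
split => [u au u1|u u0 ua uz].
  have [x [/andP[x0 _] xz] xu] : exists2 x, A x & x < u.
    have uA : 0 < u - inf A by rewrite subr_gt0.
    have [x Ax] := inf_adherent uA (conj (ex_intro _ c cA) lA).
    by rewrite addrC subrK; exists x.
  exact: (sstar_mono x0 (ltW xu) u1).
have uA : A u.
  split => //; rewrite u0; apply: (le_trans ua); apply: le_trans c1; exact: ge_inf.
have [x Ax xu] := Aopen u uA.
have : inf A <= x by exact: ge_inf.
by rewrite leNgt (lt_le_trans xu).
Qed.

(** The continuation is [hull_extension] for [z], relevant only down to the threshold of [z]: above
    it [z] stays minimal and [slope_min] passes the equation to the other minimal vectors; below it
    [z] never returns. *)
Lemma solution_extend v c G z : 0 < c -> c <= 1 -> solution_above v c G ->
  mini c v z -> exists a G', [/\ 0 <= a < c, solution_above v a G' &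
    forall u, 0 < u -> u <= a -> ~ S u v z].
Proof.
move=> c0 c1 [Gi G0 GL _ Gs] zmin.
have [a /andP[a0 ac] [aS anS]] := sstar_threshold c0 c1 zmin.1.
have M0 : 0 <= itg G c 1.
  by apply: itg_ge0 => u cu u1; apply: G0 => //; exact: lt_trans cu.
have Lzv x : a < x -> x <= 1 -> L z x = L v x.
  move=> ax x1; have x0 := le_lt_trans a0 ax.
  exact: (lower_bound_eq x0 (lexx x) x1 (aS _ ax x1)).
have := @hull_extension _ (L z) c (itg G c 1) c0 M0.
case=> [x y x0 xy yc|||g [gi g0 gE gL gs]].
- by apply: lower_bound_anti => //; exact: le_trans c1.
- by rewrite Lzv.
- by rewrite lower_bound0; exact: (@H1 z).
pose G' x := if x <= c then g x else G x.
have Gi1 : integ G c 1 by apply: integS Gi => //; exact: ltW.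
have G'i : integ G' 0 1 by apply: integ_if => //; exact: ltW.
have G'c1 x : c <= x -> itg G' x 1 = itg G x 1.
  by move=> cx; apply: eq_itg => u xu _; rewrite /G' leNgt (le_lt_trans cx).
have G'x x : 0 <= x -> x <= c -> itg G' x 1 = itg G c 1 + itg g x c.
  move=> x0 xc; rewrite (itg_split xc c1); last exact: integS G'i.
  by rewrite G'c1 // addrC; congr (_ + _); apply: eq_itg => u _ uc; rewrite /G' uc.
have G'0 u : 0 < u -> u <= 1 -> 0 <= G' u.
  by move=> u0 u1; rewrite /G'; case: ifP => uc; [exact: g0|exact: G0].
have G'L rho : a < rho -> rho <= 1 -> itg G' rho 1 <= L v rho.
  move=> ar r1; have r0 := le_lt_trans a0 ar.
  have [rc|cr] := leP rho c; last by rewrite (G'c1 _ (ltW cr)) (Gs _ cr r1).1.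
  by rewrite (G'x _ (ltW r0) rc) -Lzv // gL.
exists a, G'; split => //; first by rewrite a0.
split=> //.
(* The bound at [a] is a limit of bounds at [rho > a]: the mass on []a, rho]] is small and the lower
   bound is antitone. *)
- apply/ler_addgt0Pr => e e0; have [d d0 dP] := itg_small G'i e0.
  pose rho := Num.min c (a + d / 2).
  have ar : a < rho by rewrite /rho lt_min ac /=; lra.
  have rc : rho <= c by rewrite /rho ge_min lexx.
  have rd : rho <= a + d / 2 by rewrite /rho ge_min lexx orbT.
  have r1 := le_trans rc c1.
  rewrite (itg_split (ltW ar) r1); last exact: integS G'i.
  have := dP a rho a0 (ltW ar) r1; rewrite ltr_norml => /(_ _)/andP[]; first by lra.
  (* Both comparisons are combined here: the mass above [rho] is at most [L v rho], hence at most
     [L v a]. *)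
  have := G'L rho ar r1; have := lower_bound_anti v a0 (ltW ar) r1; lra.
(* If [a = 0], then [z] is consistent with [v] at every seed, so the total mass [f z] equals
   [f v]. *)
- move=> aE; rewrite G'x ?lexx ?ltW // gE lower_bound0; apply: sstar_all_eq.
  by move=> u u0 u1; apply: aS; rewrite ?aE.
move=> rho ar r1; split; first exact: G'L.
move=> w wmin; have r0 := le_lt_trans a0 ar.
have [rc|cr] := leP rho c; last first.
  by rewrite G'c1 ?ltW // /G' leNgt cr /=; apply: (Gs _ cr r1).2.
have zr : mini rho v z.
  by apply: (min_prec_le r0 rc c1 zmin); exact: aS.
apply: (slope_min r0 r1 _ _ zr wmin).
- apply: itg_ge0 => u ru u1; apply: G'0 => //; exact: lt_trans ru.
- exact: G'L.
- by rewrite (G'x _ (ltW r0) rc) /G' rc; exact: gs.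
Qed.

Lemma finite_set_list (F : set V) : finite_set F ->
  exists s : seq V, forall z, F z -> List.In z s.
Proof.
move=> [n]; elim: n F => [|n IH] F.
  by rewrite II0 card_eq0 => /eqP ->; exists [::].
move=> /eq_cardSP [x Fx /IH [s sP]]; exists (x :: s) => z Fz.
have [<-|zx] := pselect (x = z); [by left|right; apply: sP; split => // xz].
by apply: zx.
Qed.

(** Induction on the number of candidate vectors: each extension uses one up, since its vector is
    inconsistent at all remaining seeds. The start is the zero function at [c = 1]. *)
Lemma solution_exists v : exists G, solution_above v 0 G.
Proof.
have gen n : forall s c G, (size s <= n)%N -> 0 <= c -> c <= 1 -> solution_above v c G ->
    (forall u, 0 < u -> u <= c -> exists2 z, List.In z s & mini u v z) ->
    exists G', solution_above v 0 G'.
  elim: n => [|n IH] s c G sn; rewrite le_eqVlt => /predU1P[<-|c0] c1 Gs sP;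
    try by exists G.
    have [z] := sP c c0 (lexx c); by case: s sn {sP}.
  have [z zs zmin] := sP c c0 (lexx c).
  have [a [G' [/andP[a0 ac] G's aS]]] := solution_extend c0 c1 Gs zmin.
  have [s1 [s2 sE]] := List.in_split z s zs.
  apply: (IH (s1 ++ s2) a G') => //.
  - by move: sn; rewrite sE !size_cat /= addnS ltnS.
  - exact: ltW (lt_le_trans ac c1).
  move=> u u0 ua; have [w ws wmin] := sP u u0 (le_trans ua (ltW ac)).
  exists w => //; move: ws; rewrite sE => /List.in_app_iff [?|[zw|?]].
  - by apply/List.in_app_iff; left.
  - by case: (aS u u0 ua); rewrite zw; exact: wmin.1.
  - by apply/List.in_app_iff; right.
have [F /finite_set_list[s sP] FP] := H4 v.
apply: (gen (size s) s 1 (fun=> 0)) => //.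
  split; rewrite ?itg_refl //; first exact: integ_cst.
  - exact: lower_bound_ge0.
  - by move=> /eqP; rewrite oner_eq0.
  - by move=> rho /lt_le_trans h /h; rewrite ltxx.
move=> u u0 u1; have [|z Fz zmin] := FP u; first by rewrite u0.
by exists z => //; exact: sP.
Qed.

Lemma min_exists u v : 0 < u -> u <= 1 -> exists z, mini u v z.
Proof.
move=> u0 u1; have [F _ /(_ u)] := H4 v; rewrite u0 => /(_ u1) [z _ zmin].
by exists z.
Qed.

(** Suppose [G1] has more mass above [u]. Up to the first point [s] where the excess [D] is gone,
    [G1 <= G2] because slopes decrease with the mass; so [D] is nondecreasing there, against
    [D s <= 0 < D u]. *)
Lemma solution_itg_le u y v G1 G2 : 0 < u -> u <= 1 -> S u y v ->
  solution_above y 0 G1 -> solution_above v 0 G2 -> itg G1 u 1 <= itg G2 u 1.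
Proof.
move=> u0 u1 yv [i1 _ _ _ s1] [i2 _ _ _ s2].
have Dsplit x x' : 0 <= x -> x <= x' -> x' <= 1 -> itg G1 x 1 - itg G2 x 1 =
    itg (fun t => G1 t - G2 t) x x' + (itg G1 x' 1 - itg G2 x' 1).
  move=> x0 xx x1; rewrite (itg_split xx x1 (integS x0 (lexx 1) i1)).
  rewrite (itg_split xx x1 (integS x0 (lexx 1) i2)) itgB; last 2 first.
  - exact: integS i1.
  - exact: integS i2.
  ring.
pose D x := itg G1 x 1 - itg G2 x 1.
have Dc : ucont D u 1.
  move=> e e0; have [d d0 dP] := itg_small (integB i1 i2) e0.
  exists d => // x x' ux xx x1 xxd.
  rewrite /D [X in _ - X](Dsplit x x') ?(le_trans (ltW u0)) //.
  rewrite opprD addrA addrAC subrr add0r normrN.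
  by apply: dP => //; lra.
rewrite leNgt; apply/negP => lt12.
have Du : 0 < D u by rewrite subr_gt0.
have D1 : D 1 <= 0 by rewrite /D !itg_refl subrr.
have [s /andP[us s1'] [Ds DsP]] := first_nonpos u1 Dc Du D1.
have [d d0 dP] := Dc _ Du.
(* Stopping at [x0 < s] keeps [D] positive on []u, x0]], while continuity still gives
   [D x0 < D u]. *)
pose x0 := Num.max u (s - d / 2).
have x0s : x0 < s by rewrite /x0 gt_max us /=; lra.
have ux0 : u <= x0 by rewrite /x0 le_max lexx.
have x0d : s - d / 2 <= x0 by rewrite /x0 le_max lexx orbT.
have := dP x0 s ux0 (ltW x0s) s1'; rewrite ltr_norml => /(_ _)/andP[]; first by lra.
have := Dsplit u x0 (ltW u0) ux0 (le_trans (ltW x0s) s1'); rewrite -/(D u) -/(D x0).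
have : itg (fun t => G1 t - G2 t) u x0 <= itg (fun=> 0) u x0.
  apply: itg_le; [|exact: integ_cst|].
    by apply: integS (integB i1 i2); [exact: ltW|lra].
  move=> x ux xx0; have x00 : 0 < x by lra.
  have x1 : x <= 1 by lra.
  have [z zmin] := min_exists v x00 x1.
  have zmin' : mini x y z by rewrite /mini -(sstar_eq u0 (ltW ux) x1 yv).
  rewrite subr_le0.
  apply: (slope_le ((s2 x x00 x1).2 z zmin) ((s1 x x00 x1).2 z zmin')).
  by rewrite -subr_ge0 ltW // (DsP x) ?ltW //; exact: le_lt_trans x0s.
rewrite itg_cst // mul0r; lra.
Qed.

(** Equal masses above [u] and a common minimal vector leave a single slope; letting [y] and [v]
    differ shows that the value depends on the outcome alone. *)
Lemma solution_unique u y v G1 G2 : 0 < u -> u <= 1 -> S u y v ->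
  solution_above y 0 G1 -> solution_above v 0 G2 -> G1 u = G2 u.
Proof.
move=> u0 u1 yv Gs1 Gs2; have E := sstar_eq u0 (lexx u) u1 yv.
have vy : S u v y by rewrite E; apply: sstar_refl; rewrite u0.
have [z zmin] := min_exists v u0 u1.
have zmin' : mini u y z by rewrite /mini -E.
have M12 : itg G1 u 1 = itg G2 u 1.
  apply/eqP; rewrite eq_le (solution_itg_le u0 u1 yv Gs1 Gs2).
  by rewrite (solution_itg_le u0 u1 vy Gs2 Gs1).
case: Gs1 => _ _ _ _ /(_ u u0 u1)[_ /(_ z zmin')]; rewrite M12 => h1.
case: Gs2 => _ _ _ _ /(_ u u0 u1)[_ /(_ z zmin)] h2.
exact: slope_unique h1 h2.
Qed.

(** The slope towards [eta = 0] bounds [G x * x] by [f z] for a minimal [z], and finitely many [z]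
    suffice. *)
Lemma solution_bounded v c G : 0 < c -> solution_above v 0 G ->
  exists B, forall x, c < x -> x <= 1 -> G x <= B.
Proof.
move=> c0 [Gi G0 _ _ Gs].
have [F /finite_set_list[s sP] FP] := H4 v.
have [K KP] : exists K, forall z, List.In z s -> f z <= K.
  elim: s {sP} => [|w s [K KP]]; first by exists 0.
  exists (Num.max (f w) K) => z [<-|/KP zK]; first by rewrite le_max lexx.
  by rewrite le_max zK orbT.
exists (K / c) => x cx x1; have x0 := lt_trans c0 cx.
have [|z Fz zmin] := FP x; first by rewrite x0.
have [/(_ 0 (lexx 0) x0) h _] := (Gs x x0 x1).2 z zmin.
rewrite subr0 lower_bound0 in h.
have M0 : 0 <= itg G x 1.
  by apply: itg_ge0 => t xt t1; apply: G0 => //; exact: lt_trans xt.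
have zK := KP z (sP z Fz).
rewrite ler_pdivlMr //.
have : G x * c <= G x * x by rewrite ler_wpM2l ?G0 // ltW.
lra.
Qed.

(** * Optimality of the solution and equivalence of optimal estimators *)

Section optimal.
Hypothesis H3 : forall (u : R) (y v : V), 0 < u <= 1 -> S u y v ->
  exists2 z, min_prec prec (S u y) z & prec z v \/ z = v.
Hypothesis finite_variance : forall v, exists2 e, nonneg_unbiased S f e &
  (est_variance S f e v < +oo)%E.
Variable G : V -> R -> R.
Hypothesis Gsol : forall v, solution_above v 0 (G v).

(** At a seed in []0, 1]] any data vector with the given outcome serves equally well, by
    [solution_unique]; pairs that are not outcomes get the default [0]. *)
Definition solution_estimator (p : R * set V) : R :=
  if pselect (exists y, S p.1 y = p.2) is left yP then G (projT1 (cid yP)) p.1 else 0.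

Let opt := solution_estimator.

Lemma solution_estimatorE u v : 0 < u -> u <= 1 -> est_at S opt u v = G v u.
Proof.
move=> u0 u1; rewrite /est_at /opt /solution_estimator /=.
case: pselect => [yP|[]]; last by exists v.
case: (cid yP) => y /= yv; apply: (solution_unique u0 u1 _ (Gsol y) (Gsol v)).
by rewrite yv; apply: sstar_refl; rewrite u0.
Qed.

Let integG v : integ (G v) 0 1. Proof. by case: (Gsol v). Qed.

Lemma solution_estimator_unbiased : nonneg_unbiased S f opt.
Proof.
split=> [v|u v /andP[u0 u1]|v].
- by apply: (eq_integ _ (integG v)) => u u0 u1; rewrite solution_estimatorE.
- by rewrite solution_estimatorE //; case: (Gsol v) => _ G0 _ _ _; exact: G0.
- transitivity (itg (G v) 0 1); last by case: (Gsol v) => _ _ _ /(_ erefl).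
  by apply: eq_itg => u u0 u1; rewrite solution_estimatorE.
Qed.

Lemma solution_estimator_lambda : lambda_solution S f prec opt.
Proof.
split=> [|v rho /andP[r0 r1] z zmin]; first by case: solution_estimator_unbiased.
case: (Gsol v) => _ _ _ _ /(_ rho r0 r1) [_ /(_ z zmin) zs].
rewrite solution_estimatorE // -(inf_slopeE r0 zs); congr inf_slope.
by apply: eq_itg => u ru u1; rewrite solution_estimatorE //; exact: lt_trans ru.
Qed.

Lemma est_varianceE e v : integ (fun u => est_at S e u v ^+ 2) 0 1 ->
  est_variance S f e v = (itg (fun u => est_at S e u v ^+ 2) 0 1 - f v ^+ 2)%:E.
Proof.
move=> ie; rewrite /est_variance EFinB /itg /Rintegral fineK //.
exact: (integrable_fin_num _ ie).
Qed.

Lemma est_variance_lty e v : nonneg_unbiased S f e ->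
  (est_variance S f e v < +oo)%E <-> integ (fun u => est_at S e u v ^+ 2) 0 1.
Proof.
move=> /(nonneg_unbiased_itg v) [ei _ _].
have me : measurable_fun (`]0, 1]%classic : set R) (fun u => est_at S e u v ^+ 2).
  by apply: measurable_funX; exact: integ_measurable ei.
have E : (\int[mu]_(u in seeds) `|(est_at S e u v ^+ 2)%:E| =
    \int[mu]_(u in seeds) (est_at S e u v ^+ 2)%:E)%E.
  by apply: eq_integral => u _; rewrite /= ger0_norm ?sqr_ge0.
rewrite /est_variance; split => [|ie].
  move=> vlt; apply/integrableP; split; first exact/measurable_EFinP.
  rewrite [ltLHS]E; case: (\int[mu]_(u in seeds) _)%E vlt => //= r _.
  exact: ltry.
by move: (est_varianceE ie); rewrite /est_variance => ->; rewrite ltry.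
Qed.

Lemma ae_eq_est_variance e h v : nonneg_unbiased S f e -> nonneg_unbiased S f h ->
  {ae mu, forall u, 0 < u <= 1 -> est_at S e u v = est_at S h u v} ->
  est_variance S f e v = est_variance S f h v.
Proof.
move=> /(nonneg_unbiased_itg v) [ei _ _] /(nonneg_unbiased_itg v) [hi _ _] eh.
congr (_ - _)%E; apply: ge0_ae_eq_integral => //=.
- exact: measurable_itv.
- by apply/measurable_EFinP; apply: measurable_funX; exact: integ_measurable ei.
- by apply/measurable_EFinP; apply: measurable_funX; exact: integ_measurable hi.
- by move=> u _; rewrite lee_fin sqr_ge0.
- by move=> u _; rewrite lee_fin sqr_ge0.
by apply: ae_imp eh => u uP; rewrite /seeds /= in_itv /= => /uP ->.
Qed.

Let Gmin_slope z c x : 0 < c -> c <= 1 -> mini c z z -> 0 < x -> x <= c ->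
  is_slope (L z) x (f z - itg (G z) 0 x) (G z x).
Proof.
move=> c0 c1 zmin x0 xc; have x1 := le_trans xc c1.
case: (Gsol z) => Gi _ _ /(_ erefl) <- /(_ x x0 x1)[_ /(_ z)].
rewrite (itg_split (ltW x0) x1 Gi) addrAC subrr add0r; apply.
by apply: (min_prec_le x0 xc c1 zmin); apply: sstar_refl; rewrite x0.
Qed.

(** Above [c] the solution is bounded. Below [c] it is compared with an estimator of finite variance
    on [z], raised by a constant so that its mass suffices for [slope_solution_min_norm]. *)
Let Gsq_integ z c : 0 < c -> c <= 1 -> mini c z z ->
  integ (fun u => G z u ^+ 2) 0 1.
Proof.
move=> c0 c1 zmin; have [Gi G0 _ GE Gs] := Gsol z.
have [B BP] := solution_bounded c0 (Gsol z).
apply: (integ_cat (ltW c0) c1); last first.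
  apply: (@integ_le _ _ (fun=> B ^+ 2)); last exact: integ_cst.
    apply: measurable_funX; apply: integ_measurable.
    by apply: integS Gi => //; exact: ltW.
  move=> x cx x1; have Gx := G0 x (lt_trans c0 cx) x1.
  by rewrite ger0_norm ?sqr_ge0 // ler_sqr ?nnegrE ?BP // (le_trans Gx) ?BP.
have [e eP evar] := finite_variance z.
have [ei e0 eE] := nonneg_unbiased_itg z eP.
pose E u := est_at S e u z.
have e2 : integ (fun u => E u ^+ 2) 0 1 by exact: (est_variance_lty z eP).1.
have ei0 : integ E 0 c by exact: integS ei.
have e20 : integ (fun u => E u ^+ 2) 0 c by exact: integS e2.
(* Then [k * c] makes up for any mass that [E] places above [c] in excess of [G z]; the maximum with
   [0] keeps [k] nonnegative, so adding [k] preserves the constraint. *)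
pose k := Num.max (itg E c 1 - itg (G z) c 1) 0 / c.
have k0 : 0 <= k by rewrite divr_ge0 ?le_max ?lexx ?orbT // ltW.
have kc : itg E c 1 - itg (G z) c 1 <= k * c.
  by rewrite /k divfK ?gt_eqF // le_max lexx.
pose phi u := E u + k.
have phii : integ phi 0 c by apply: integD => //; exact: integ_cst.
have phiE x : 0 < x -> x <= c -> itg phi 0 x = itg E 0 x + k * x.
  move=> x0 xc; rewrite itgD; [|exact: integS ei0|exact: integ_cst].
  by rewrite itg_cst ?subr0 // ltW.
have Esplit x : 0 <= x -> x <= 1 -> itg E x 1 = f z - itg E 0 x.
  by move=> x0 x1; rewrite -eE (itg_split x0 x1 ei) addrAC subrr add0r.
have Gsplit : itg (G z) c 1 = f z - itg (G z) 0 c.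
  by rewrite -GE // (itg_split (ltW c0) c1 Gi) addrAC subrr add0r.
apply: (proj1 (@slope_solution_min_norm _ (L z) _ _ (f z) c0 _ _ _ phi phii _ _ _)).
- exact: integS Gi.
- move=> x x0 xc; exact: (Gmin_slope c0 c1 zmin).
- by move=> x x0 xc; apply: G0 => //; exact: le_trans c1.
- move=> x x0 xc; have x1 := le_trans xc c1; rewrite phiE //.
  have := nonneg_unbiased_itg_le z eP x0 x1; rewrite -/E -/(L z x) (Esplit x (ltW x0) x1).
  have := mulr_ge0 k0 (ltW x0); lra.
- rewrite phiE //; have := Esplit c (ltW c0) c1; lra.
have s2 : integ (fun u => 2 * E u ^+ 2 + 2 * k ^+ 2) 0 c.
  by apply: integD; [exact: integZ|exact: integ_cst].
apply: (integ_le _ _ s2).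
  by apply: measurable_funX; exact: integ_measurable phii.
move=> x _ _; rewrite ger0_norm ?sqr_ge0 // /phi sqrrD.
have := sqr_ge0 (E x - k); rewrite sqrrB; lra.
Qed.

(** Above [c] the second moments agree, and unbiasedness makes the masses below [c] equal. As [z] is
    minimal at all seeds up to [c], [slope_solution_unique] applies on []0, c]]. *)
Lemma solution_estimator_strict e z c : nonneg_unbiased S f e ->
  0 < c -> c <= 1 -> mini c z z ->
  {ae mu, forall u, c < u <= 1 -> est_at S e u z = est_at S opt u z} ->
  (est_variance S f e z <= est_variance S f opt z)%E ->
  {ae mu, forall u, 0 < u <= 1 -> est_at S e u z = est_at S opt u z}.
Proof.
move=> eP c0 c1 zmin ea var.
have [ei e0 eE] := nonneg_unbiased_itg z eP.
have [Gi G0 _ /(_ erefl) GE Gs] := Gsol z.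
have G2 := Gsq_integ c0 c1 zmin.
pose E u := est_at S e u z.
have optG u : 0 < u -> u <= 1 -> est_at S opt u z = G z u by exact: solution_estimatorE.
have opt2 : integ (fun u => est_at S opt u z ^+ 2) 0 1.
  by apply: eq_integ G2 => u u0 u1; rewrite optG.
have vopt := (est_variance_lty z solution_estimator_unbiased).2 opt2.
have e2 := (est_variance_lty z eP).1 (le_lt_trans var vopt).
move: var; rewrite (est_varianceE e2) (est_varianceE opt2) lee_fin lerD2r.
rewrite (@eq_itg _ (fun u => est_at S opt u z ^+ 2) (fun u => G z u ^+ 2)); last first.
  by move=> u u0 u1; rewrite optG.
have ea' : {ae mu, forall u, c < u <= 1 -> E u = G z u}.
  apply: ae_imp ea => u uP /andP[cu u1]; rewrite /E uP ?cu // optG //.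
  exact: lt_trans cu.
rewrite (itg_split (ltW c0) c1 e2) (itg_split (ltW c0) c1 G2).
rewrite (@ae_eq_itg _ _ (fun u => G z u ^+ 2) c 1); last first.
- by apply: ae_imp ea' => u uP /uP <-.
- by apply: integS G2 => //; exact: ltW.
- by apply: integS e2 => //; exact: ltW.
rewrite lerD2r => var.
have Ec : itg E c 1 = itg (G z) c 1.
  by apply: ae_eq_itg => //; [apply: integS ei|apply: integS Gi] => //; exact: ltW.
have tot : itg E 0 1 = itg (G z) 0 1 by rewrite GE.
rewrite (itg_split (ltW c0) c1 ei) (itg_split (ltW c0) c1 Gi) Ec in tot.
have below : {ae mu, forall u, 0 < u <= c -> E u = G z u}.
  apply: (@slope_solution_unique _ (L z) _ _ (f z) c0) => //.
  - exact: integS Gi.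
  - by move=> x x0 xc; exact: (Gmin_slope c0 c1 zmin).
  - by move=> x x0 xc; apply: G0 => //; exact: le_trans c1.
  - move=> x x0 xc; have x1 := le_trans xc c1.
    have [+ _] := Gs x x0 x1; rewrite -GE (itg_split (ltW x0) x1 Gi).
    by rewrite addrAC subrr add0r.
  - exact: integS ei.
  - move=> x x0 xc; have x1 := le_trans xc c1.
    have := nonneg_unbiased_itg_le z eP x0 x1; rewrite -eE (itg_split (ltW x0) x1 ei).
    by rewrite addrAC subrr add0r.
  - by move/addIr: tot => ->.
  - exact: integS e2.
  - exact: integS G2.
apply: ae_and below ea' => u ub ua /andP[u0 u1]; rewrite optG //.
by have [uc|cu] := leP u c; [apply: ub; rewrite u0|apply: ua; rewrite cu].
Qed.

(* Descend from seed 1: agreement above c extends below c along some z in S c v. *)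
Lemma ae_eq_descent e v :
  (forall c, 0 < c -> c <= 1 ->
    {ae mu, forall u, c < u <= 1 -> est_at S e u v = est_at S opt u v} ->
    exists2 z, S c v z &
      {ae mu, forall u, 0 < u <= 1 -> est_at S e u z = est_at S opt u z}) ->
  {ae mu, forall u, 0 < u <= 1 -> est_at S e u v = est_at S opt u v}.
Proof.
move=> step.
pose P c := {ae mu, forall u, c < u <= 1 -> est_at S e u v = est_at S opt u v}.
pose A := [set c : R | 0 <= c <= 1 /\ P c].
have A1 : A 1.
  split; first by rewrite ler01 lexx.
  by apply: aeW => u /andP[/lt_le_trans h /h]; rewrite ltxx.
have lA : has_lbound A by exists 0 => c [/andP[]].
pose c := inf A.
have c0 : 0 <= c by apply: lb_le_inf; [exists 1|move=> x [/andP[]]].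
have c1 : c <= 1 by exact: ge_inf.
have Pc : P c.
  (* Agreement above the infimum itself is a countable intersection of almost everywhere
     statements. *)
  have Pn n : {ae mu, forall u, c + n.+1%:R^-1 < u <= 1 ->
      est_at S e u v = est_at S opt u v}.
    have n0 : 0 < n.+1%:R^-1 :> R by rewrite invr_gt0.
    have [x [_ Px] xc] := inf_adherent n0 (conj (ex_intro _ 1 A1) lA).
    apply: ae_imp Px => u uP /andP[cu u1]; apply: uP.
    by rewrite u1 (lt_trans xc).
  have := ae_foralln Pn; apply: ae_imp => u uP /andP[cu u1].
  have [n /ltW nP] : exists n : nat, (u - c)^-1 < n%:R.
    exists (Num.bound (u - c)^-1); apply: archi_boundP.
    by rewrite invr_ge0 subr_ge0 ltW.
  apply: (uP n); rewrite u1 andbT -ltrBrDl.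
  rewrite invf_plt ?posrE ?subr_gt0 //; apply: (le_lt_trans nP).
  by rewrite ltr_nat.
have [cpos|/(conj c0)/andP/le_anti cE] := ltP 0 c; last by rewrite -cE in Pc.
(* If [c > 0], then [z] is still consistent with [v] at some [x < c], so agreement along [z] gives
   agreement along [v] above [x], contradicting the choice of [c]. *)
have [z vz za] := step c cpos c1 Pc.
have [d d0 dP] := sstar_left_open (ltac:(by rewrite cpos) : 0 < c <= 1) vz.
pose x := Num.max (c / 2) (c - d / 2).
have x0 : 0 < x by rewrite /x lt_max divr_gt0.
have xc : x < c by rewrite /x gt_max; apply/andP; split; lra.
have xd : c - d < x by rewrite /x lt_max; apply/orP; right; lra.
have xz : S x v z by apply: dP => //; rewrite x0 ltW // (lt_le_trans xc).
have : c <= x.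
  apply: ge_inf => //; split; first by rewrite !ltW //= (lt_le_trans xc).
  apply: ae_imp za => u uP /andP[xu u1].
  by rewrite -!(est_at_eq _ x0 (ltW xu) u1 xz) uP // (lt_trans x0 xu).
by rewrite leNgt xc.
Qed.

(** The vector from [H3] precedes or equals [v], so a competitor does at least as well there and
    [solution_estimator_strict] applies; agreement along [v] then rules out a strict improvement. *)
Lemma solution_estimator_optimal : prec_plus_optimal S f prec opt.
Proof.
split; first exact: solution_estimator_unbiased.
move=> [e eP [v vlt vle]].
suff /(ae_eq_est_variance eP solution_estimator_unbiased) vE :
    {ae mu, forall u, 0 < u <= 1 -> est_at S e u v = est_at S opt u v}.
  by move: vlt; rewrite vE ltxx.
apply: ae_eq_descent => c c0 c1 ca.
have cc : 0 < c <= 1 by rewrite c0.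
have [z zmin zv] := H3 cc (sstar_refl S v cc).
have vz := zmin.1; exists z => //.
have E := sstar_eq c0 (lexx c) c1 vz.
apply: (solution_estimator_strict eP c0 c1); first by rewrite /mini E.
  apply: ae_imp ca => u uP /andP[cu u1].
  by rewrite !(est_at_eq _ c0 (ltW cu) u1 vz) uP // cu.
by case: zv => [/vle //|->]; exact: ltW.
Qed.

Lemma optimal_ae_eq e : prec_plus_optimal S f prec e -> est_equivalent S e opt.
Proof.
move=> [eP eopt] v.
suff : {ae mu, forall u, 0 < u <= 1 -> est_at S e u v = est_at S opt u v}.
  by apply: ae_imp => u uP; rewrite /seeds /= in_itv.
apply: ae_eq_descent => c c0 c1 ca.
have cc : 0 < c <= 1 by rewrite c0.
have [z zmin] := min_exists v c0 c1.
have vz := zmin.1; exists z => //.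
have E := sstar_eq c0 (lexx c) c1 vz.
have za : {ae mu, forall u, c < u <= 1 -> est_at S e u z = est_at S opt u z}.
  apply: ae_imp ca => u uP /andP[cu u1].
  by rewrite !(est_at_eq _ c0 (ltW cu) u1 vz) uP // cu.
have zmin' : mini c z z by rewrite /mini E.
have [|opt_lt] := leP (est_variance S f e z) (est_variance S f opt z).
  exact: (solution_estimator_strict eP c0 c1 zmin' za).
(* Otherwise switch from e to opt on the outcomes below the one of z at c. *)
exfalso; apply: eopt.
(* The test must depend on the outcome alone: [p.2] included in [S c z] says that every consistent
   vector, hence the data, lies in [S c z]. *)
pose e' (p : R * set V) := if asbool (p.1 <= c /\ p.2 `<=` S c z) then opt p else e p.
have e'out u y : 0 < u -> u <= 1 -> ~ S c z y -> est_at S e' u y = est_at S e u y.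
  move=> u0 u1 zy; rewrite /est_at /e' /=; case: asboolP => // -[_ sub].
  by case: zy; apply: sub; apply: sstar_refl; rewrite u0.
have e'le u y : 0 < u -> u <= c -> S c z y -> est_at S e' u y = est_at S opt u y.
  move=> u0 uc zy; rewrite /est_at /e' /=; case: asboolP => // -[]; split => //.
  rewrite -(sstar_eq c0 (lexx c) c1 zy); exact: (sstar_mono u0 uc c1).
have e'gt u y : c < u -> est_at S e' u y = est_at S e u y.
  by move=> cu; rewrite /est_at /e' /=; case: asboolP => // -[]; rewrite leNgt cu.
have e'ae y : S c z y ->
    {ae mu, forall u, 0 < u <= 1 -> est_at S e' u y = est_at S opt u y}.
  move=> zy; apply: ae_imp za => u uP /andP[u0 u1].
  have [uc|cu] := leP u c; first exact: e'le.
  by rewrite e'gt // !(est_at_eq _ c0 (ltW cu) u1 zy) uP // cu.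
have e'i y : integ (fun u => est_at S e' u y) 0 1.
  have [ei _ _] := nonneg_unbiased_itg y eP.
  have [zy|zy] := pselect (S c z y); last first.
    by apply: eq_integ ei => u u0 u1; rewrite e'out.
  apply: (integ_cat (ltW c0) c1).
    have : integ (G y) 0 c by apply: integS (integG y).
    apply: eq_integ => u u0 uc; rewrite e'le // solution_estimatorE //.
    exact: le_trans c1.
  have : integ (fun u => est_at S e u y) c 1 by apply: integS ei => //; exact: ltW.
  by apply: eq_integ => u cu u1; rewrite e'gt.
have e'P : nonneg_unbiased S f e'.
  split=> [y|u y|y]; first exact: e'i.
    move=> /andP[u0 u1]; rewrite /est_at /e'; case: ifP => _.
      by have [_ + _] := nonneg_unbiased_itg y solution_estimator_unbiased; apply.
    by have [_ + _] := nonneg_unbiased_itg y eP; apply.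
  (* Along [y] in [S c z] the patched estimator is almost everywhere [opt], because [e] already
     agrees with [opt] above [c]; along other vectors it is [e]. *)
  have [zy|zy] := pselect (S c z y).
    have [oi _ <-] := nonneg_unbiased_itg y solution_estimator_unbiased.
    apply: ae_eq_itg => //; exact: e'ae.
  have [_ _ <-] := nonneg_unbiased_itg y eP.
  by apply: eq_itg => u u0 u1; rewrite e'out.
exists e' => //; exists z.
  rewrite (ae_eq_est_variance e'P solution_estimator_unbiased) //.
  by apply: e'ae; exact: zmin'.1.
(* A vector preceding [z] is not in [S c z], by minimality of [z], so nothing changes along it. *)
move=> y yz; rewrite (ae_eq_est_variance e'P eP) //; apply: aeW => u /andP[u0 u1].
apply: e'out => // zy; case: zmin' => _; apply; exists y => //.
Qed.

End optimal.
End order.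
End scheme.

Unset Implicit Arguments.

Theorem lemma5p1 (R : realType) (V : Type) (S : sampling_scheme R V)
    (f : V -> R) (prec : V -> V -> Prop)
    (f_ge0 : forall v, 0 <= f v)
    (prec_strict : StrictOrder prec)
    (* implicit in comparing variances, and not a consequence of H1-H4 *)
    (finite_variance : forall v, exists2 e, nonneg_unbiased S f e &
       (est_variance S f e v < +oo)%E)
    (H1 : forall v, lower_bound S f u v @[u --> 0^'+] --> f v)
    (H2 : forall (rho : R) (v : V) (x : R) (z w : V), 0 < rho <= 1 ->
       0 < x <= lower_bound S f rho v ->
       min_prec prec (S rho v) z -> min_prec prec (S rho v) w ->
       inf_slope S f rho z x = inf_slope S f rho w x)
    (H3 : forall (u : R) (y v : V), 0 < u <= 1 -> S u y v ->
       exists2 z, min_prec prec (S u y) z & prec z v \/ z = v)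
    (H4 : forall v, exists2 F : set V, finite_set F &
       forall u : R, 0 < u <= 1 -> exists2 z, F z & min_prec prec (S u v) z) :
  (exists e, prec_plus_optimal S f prec e) /\
  (forall e, prec_plus_optimal S f prec e ->
     exists2 g, lambda_solution S f prec g & est_equivalent S e g).
Proof.
have [G GP] := choice (solution_exists f_ge0 H1 H2 H4).
split; first by exists (solution_estimator S G); exact: solution_estimator_optimal.
move=> e eopt; exists (solution_estimator S G).
  exact: solution_estimator_lambda.
exact: optimal_ae_eq eopt.
Qed.
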